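(* Consider the $T$-periodic linear impulsive Hamiltonian system $$x'=a(t)x+b(t)u,\quad u'=-c(t)x-a(t)u,\quad t\neq\tau_i,$$ $$x(\tau_i+)=\alpha_i x(\tau_i-),\quad u(\tau_i+)=\alpha_i u(\tau_i-)-\beta_i x(\tau_i-),\qquad t\in\mathbb R,\ i\in\mathbb Z,$$ under the standing assumptions on $T$, $r$, $\tau_i$, $\alpha_i$, $\beta_i$, $a$, $b$, $c$ listed in the context. Assume that $$\prod_{i=1}^{r}\alpha_i^2=1;$$ $$\exp\left(2\int_0^T|a(u)|\,du\right)\left[\int_0^T b(t)\,dt\right]\left[\int_0^T c^+(t)\,dt+\sum_{i=1}^r\left(\frac{\beta_i}{\alpha_i}\right)^+\right]<4;$$ $$b(t)>0,\qquad \int_0^T\left(c(t)-\frac{a^2(t)}{b(t)}\right)\,dt+\sum_{i=1}^r\frac{\beta_i}{\alpha_i}=0;$$ that $a/b\in C[0,T]$; and that at least one of the following statements holds: (C1) $\beta_i\neq0$ for some $i\in\{1,\dots,r\}$; (C2) $\beta_i=0$ for all $i\in\{1,\dots,r\}$, and $a/b\notin \mathrm{PC}^1[0,T]$; (C3) $\beta_i=0$ for all $i\in\{1,\dots,r\}$, $a/b\in \mathrm{PC}^1[0,T]$, and $$\left(\frac{a(t)}{b(t)}\right)'-c(t)+\frac{a^2(t)}{b(t)}\not\equiv0.$$ Then the impulsive system is stable.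
   Context: Standing assumptions: $T>0$ is a real number and $r$ is a positive integer. $\{\tau_i\}_{i\in\mathbb Z}$ is a sequence of real numbers (impulse points) with $\tau_i<\tau_{i+1}$ and $\tau_{i+r}=\tau_i+T$ for all $i\in\mathbb Z$, and $0<\tau_1<\tau_2<\cdots<\tau_r<T$. The functions $a,b,c:\mathbb R\setminus\{\tau_i: i\in\mathbb Z\}\to\mathbb R$ satisfy $a(t+T)=a(t)$, $b(t+T)=b(t)$, $c(t+T)=c(t)$ for all $t\in\mathbb R\setminus\{\tau_i:i\in\mathbb Z\}$, and $a,b,c\in \mathrm{PC}[0,T]$. The real sequences $\{\alpha_i\},\{\beta_i\}$ ($i\in\mathbb Z$) satisfy $\alpha_i\neq0$, $\alpha_{i+r}=\alpha_i$, $\beta_{i+r}=\beta_i$ for all $i\in\mathbb Z$. Here $\mathrm{PC}[0,T]$ is the set of functions $f:[0,T]\setminus\{\tau_1,\dots,\tau_r\}\to\mathbb R$ that are continuous on $[0,T]\setminus\{\tau_1,\dots,\tau_r\}$ and for which the left-hand limit $f(\tau_i-)$ and the right-hand limit $f(\tau_i+)$ exist (finite) for each $i\in\{1,\dots,r\}$. $\mathrm{PC}^1[0,T]$ is the set of $f\in\mathrm{PC}[0,T]$ such that $f'\in\mathrm{PC}[0,T]$. Since $a$ and $b$ are not defined at the points $\tau_i$, the condition $a/b\in C[0,T]$ means that $a/b$ extends to a continuous function on $[0,T]$. Notation: $c^+(t)=\max\{c(t),0\}$ and $(\beta_i/\alpha_i)^+=\max\{\beta_i/\alpha_i,0\}$.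 A solution is a pair $(x,u)$ satisfying the differential equations for $t\ne\tau_i$, having one-sided limits at each $\tau_i$, and satisfying the jump conditions at every $\tau_i$. The system is called stable if all its solutions are bounded on $\mathbb R$. *)

(* Defs.v *)
From Stdlib Require Export Reals ZArith.
From Coquelicot Require Export Coquelicot.
Open Scope R_scope.

(* Functions that the mathematics leaves undefined at the impulse points are
   total functions here; no condition depends on their values there. *)

Definition impulse (tau : Z -> R) (t : R) : Prop :=
  exists i : Z, t = tau i.

Definition index_1_r (r : nat) (i : Z) : Prop := (1 <= i <= Z.of_nat r)%Z.

Definition PC_dom (T : R) (r : nat) (tau : Z -> R) (t : R) : Prop :=
  0 <= t <= T /\ (forall i : Z, index_1_r r i -> t <> tau i).

Definition PC (T : R) (r : nat) (tau : Z -> R) (f : R -> R) : Prop :=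
  continuous_on (PC_dom T r tau) f /\
  (forall i : Z, index_1_r r i ->
     (exists l : R, filterlim f (at_left (tau i)) (locally l)) /\
     (exists l : R, filterlim f (at_right (tau i)) (locally l))).

(* [D_in] makes the derivative one-sided at the endpoints 0 and T. *)
Definition is_PC_derivative (T : R) (r : nat) (tau : Z -> R)
    (f f' : R -> R) : Prop :=
  forall t : R, PC_dom T r tau t -> D_in f f' (PC_dom T r tau) t.

Definition PC1 (T : R) (r : nat) (tau : Z -> R) (f : R -> R) : Prop :=
  PC T r tau f /\
  (exists f' : R -> R, is_PC_derivative T r tau f f' /\ PC T r tau f').

(* f, defined on [0,T] minus the impulse points, extends to an element of
   C[0,T]. *)
Definition extends_to_C (T : R) (r : nat) (tau : Z -> R) (f : R -> R) : Prop :=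
  exists g : R -> R,
    continuous_on (fun t : R => 0 <= t <= T) g /\
    (forall t : R, PC_dom T r tau t -> g t = f t).

Definition pos_part (x : R) : R := Rmax x 0.

Definition is_solution (tau alpha beta : Z -> R) (a b c x u : R -> R) : Prop :=
  (forall t : R, ~ impulse tau t ->
     is_derive x t (a t * x t + b t * u t) /\
     is_derive u t (- c t * x t - a t * u t)) /\
  (forall i : Z, exists xm xp um up : R,
     filterlim x (at_left (tau i)) (locally xm) /\
     filterlim x (at_right (tau i)) (locally xp) /\
     filterlim u (at_left (tau i)) (locally um) /\
     filterlim u (at_right (tau i)) (locally up) /\
     xp = alpha i * xm /\
     up = alpha i * um - beta i * xm).

Definition stable (tau alpha beta : Z -> R) (a b c : R -> R) : Prop :=
  forall x u : R -> R, is_solution tau alpha beta a b c x u ->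
  exists M : R, forall t : R, ~ impulse tau t -> Rabs (x t) <= M /\ Rabs (u t) <= M.

(* Main.v *)
Require Import Defs.
From Stdlib Require Import Reals ZArith Lra Lia ClassicalEpsilon.
From Coquelicot Require Import Coquelicot.
Open Scope R_scope.

(** The factor P(t), the product of the alpha_i over the impulse points between
    0 and t (of their inverses for negative t), turns a solution (x, u) into (y, v) = (x/P, u/P), which solves the same
    differential equations with jumps
      y(tau_i+) = y(tau_i),   v(tau_i+) = v(tau_i) - gamma_i y(tau_i),
    where gamma_i = beta_i/alpha_i.  Over one period P is multiplied by 1 or
    -1, so P is bounded and it suffices to bound (y, v)
    ([solution_normalization], [step_bounded]).

    The normalized system has constant Wronskians, and it has no nontrivial
    solution with y(t+T) = rho y(t), v(t+T) = rho v(t), rho real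
    ([multiplier_riccati]):

    - If y(t0) = 0, then y(t0+T) = 0, and Lyapunov's inequality on
      [t0, t0+T] gives
        4 <= exp(2 int |a|) (int b) (int c^+ + sum gamma_i^+),
      against the hypothesis ([lyapunov_inequality]).
    - If y has no zero, w = v/y is T-periodic and solves the Riccati equation
        w' = - (c - a^2/b) - b (w + a/b)^2,  w(tau_i+) = w(tau_i) - gamma_i.
      The mean of c - a^2/b plus the sum of the gamma_i is zero, so
      b (w + a/b)^2 has integral zero and w = - a/b.  Then continuity of a/b
      forces every beta_i to vanish, a/b is piecewise C^1, and
      (a/b)' = c - a^2/b, which contradicts (C1), (C2) and (C3) respectively.

    For a nontrivial solution X = (y, v), if X(0) and X(T) are proportional,
    X itself is such a multiplier solution.  Otherwise the constancy of the
    Wronskians gives X(t+2T) = q X(t+T) - X(t) by Cramer's rule.  If |q| >= 2,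
    a root rho of rho^2 - q rho + 1 = 0 yields a multiplier solution
    X(t+T) - X(t)/rho.  So |q| < 2, and then f(t+T)^2 - q f(t) f(t+T) + f(t)^2
    is a T-periodic positive definite form in each component f of X, which
    bounds X ([normalized_solution_bounded]).  No existence theorem for the
    differential equations is needed, since the argument starts from a given
    solution.

    Products of solutions are never integrated.  Every integral identity or
    inequality is replaced by the monotonicity of an explicit function,
    assembled from solutions, antiderivatives of the coefficients and step
    functions ([pw_derive_nonincreasing]). *)

(** * Limits *)

Section RealLimits.

Context {X : Type} {F : (X -> Prop) -> Prop} {FF : Filter F}.

Lemma lim_plus (f g : X -> R) (l m : R) :
  filterlim f F (locally l) -> filterlim g F (locally m) ->
  filterlim (fun x => f x + g x) F (locally (l + m)).
Proof.
  intros Hf Hg. apply (filterlim_comp_2 f g Rplus Hf Hg).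
  exact (filterlim_plus (K := R_AbsRing) (V := R_NormedModule) l m).
Qed.

Lemma lim_mult (f g : X -> R) (l m : R) :
  filterlim f F (locally l) -> filterlim g F (locally m) ->
  filterlim (fun x => f x * g x) F (locally (l * m)).
Proof.
  intros Hf Hg. apply (filterlim_comp_2 f g Rmult Hf Hg).
  exact (filterlim_mult (K := R_AbsRing) l m).
Qed.

Lemma lim_comp (h : R -> R) (f : X -> R) (l : R) :
  continuous h l -> filterlim f F (locally l) ->
  filterlim (fun x => h (f x)) F (locally (h l)).
Proof. intros Hh Hf. exact (filterlim_comp _ _ _ f h _ _ _ Hf Hh). Qed.

End RealLimits.

Lemma continuous_left (f : R -> R) (t : R) :
  continuous f t -> filterlim f (at_left t) (locally (f t)).
Proof.
  intros H. apply filterlim_filter_le_1 with (2 := H).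
  apply filter_le_within.
Qed.

Lemma continuous_right (f : R -> R) (t : R) :
  continuous f t -> filterlim f (at_right t) (locally (f t)).
Proof.
  intros H. apply filterlim_filter_le_1 with (2 := H).
  apply filter_le_within.
Qed.

Lemma locally_two_sided (t : R) (P : R -> Prop) :
  at_left t P -> P t -> at_right t P -> locally t P.
Proof.
  unfold at_left, at_right, within. intros HL H0 HR.
  apply filter_imp with (2 := filter_and _ _ HL HR).
  intros s [H1 H2]. destruct (Rtotal_order s t) as [L|[->|L]]; auto.
Qed.

Lemma continuous_two_sided (f : R -> R) (t : R) :
  filterlim f (at_left t) (locally (f t)) ->
  filterlim f (at_right t) (locally (f t)) -> continuous f t.
Proof.
  intros HL HR P HP. apply locally_two_sided.
  - exact (HL P HP).
  - exact (locally_singleton _ _ HP).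
  - exact (HR P HP).
Qed.

Lemma at_left_open (p t : R) : p < t -> at_left t (fun s => p < s < t).
Proof.
  intros H. assert (Hd : 0 < t - p) by lra.
  exists (mkposreal _ Hd). intros s Hs Hst.
  change (Rabs (s - t) < t - p) in Hs. apply Rabs_def2 in Hs. lra.
Qed.

Lemma at_right_open (t q : R) : t < q -> at_right t (fun s => t < s < q).
Proof.
  intros H. assert (Hd : 0 < q - t) by lra.
  exists (mkposreal _ Hd). intros s Hs Hst.
  change (Rabs (s - t) < q - t) in Hs. apply Rabs_def2 in Hs. lra.
Qed.

Lemma lim_le_const {X : Type} {F : (X -> Prop) -> Prop} {FF : ProperFilter' F}
  (f : X -> R) (l m : R) :
  F (fun x => f x <= m) -> filterlim f F (locally l) -> l <= m.
Proof.
  intros H Hf.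
  exact (filterlim_le f (fun _ => m) (Finite l) (Finite m) H Hf
           (filterlim_const m)).
Qed.

Lemma lim_ge_const {X : Type} {F : (X -> Prop) -> Prop} {FF : ProperFilter' F}
  (f : X -> R) (l m : R) :
  F (fun x => m <= f x) -> filterlim f F (locally l) -> m <= l.
Proof.
  intros H Hf.
  exact (filterlim_le (fun _ => m) f (Finite m) (Finite l) H
           (filterlim_const m) Hf).
Qed.

Lemma lim_unique {X : Type} {F : (X -> Prop) -> Prop} {FF : ProperFilter' F}
  (f : X -> R) (l m : R) :
  filterlim f F (locally l) -> filterlim f F (locally m) -> l = m.
Proof.
  exact (filterlim_locally_unique (K := R_AbsRing) (V := R_NormedModule) f l m).
Qed.

Lemma at_left_shift (T t : R) (P : R -> Prop) :
  at_left t (fun s => P (s + T)) <-> at_left (t + T) P.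
Proof.
  split; intros [d Hd]; exists d; intros s Hs Hst.
  - replace s with (s - T + T) by ring. apply Hd; [|lra].
    change (Rabs (s - T - t) < d). change (Rabs (s - (t + T)) < d) in Hs.
    now replace (s - T - t) with (s - (t + T)) by ring.
  - apply Hd; [|lra].
    change (Rabs (s + T - (t + T)) < d). change (Rabs (s - t) < d) in Hs.
    now replace (s + T - (t + T)) with (s - t) by ring.
Qed.

Lemma at_right_shift (T t : R) (P : R -> Prop) :
  at_right t (fun s => P (s + T)) <-> at_right (t + T) P.
Proof.
  split; intros [d Hd]; exists d; intros s Hs Hst.
  - replace s with (s - T + T) by ring. apply Hd; [|lra].
    change (Rabs (s - T - t) < d). change (Rabs (s - (t + T)) < d) in Hs.
    now replace (s - T - t) with (s - (t + T)) by ring.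
  - apply Hd; [|lra].
    change (Rabs (s + T - (t + T)) < d). change (Rabs (s - t) < d) in Hs.
    now replace (s + T - (t + T)) with (s - t) by ring.
Qed.

Lemma lim_left_shift (f : R -> R) (T t l : R) :
  filterlim (fun s => f (s + T)) (at_left t) (locally l) <->
  filterlim f (at_left (t + T)) (locally l).
Proof.
  split; intros H P HP; specialize (H P HP); unfold filtermap in *.
  - now apply at_left_shift.
  - now apply (at_left_shift T t (fun s => P (f s))).
Qed.

Lemma lim_right_shift (f : R -> R) (T t l : R) :
  filterlim (fun s => f (s + T)) (at_right t) (locally l) <->
  filterlim f (at_right (t + T)) (locally l).
Proof.
  split; intros H P HP; specialize (H P HP); unfold filtermap in *.
  - now apply at_right_shift.
  - now apply (at_right_shift T t (fun s => P (f s))).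
Qed.

Lemma is_derive_shift (f : R -> R) (T t l : R) :
  is_derive f (t + T) l -> is_derive (fun s => f (s + T)) t l.
Proof.
  intros H.
  assert (H1 : is_derive (fun s : R => s + T) t 1) by (auto_derive; [trivial|ring]).
  pose proof (is_derive_comp f (fun s : R => s + T) t l 1 H H1) as H2.
  change (scal 1 l) with (1 * l) in H2. now rewrite Rmult_1_l in H2.
Qed.

Lemma within_left (D : R -> Prop) (f : R -> R) (t l : R) :
  at_left t D -> filterlim f (within D (locally t)) (locally l) ->
  filterlim f (at_left t) (locally l).
Proof.
  intros HD Hf P HP. specialize (Hf P HP).
  unfold filtermap, at_left, within in *.
  apply filter_imp with (2 := filter_and _ _ HD Hf). intros s [H1 H2] Hs. auto.
Qed.

Lemma within_right (D : R -> Prop) (f : R -> R) (t l : R) :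
  at_right t D -> filterlim f (within D (locally t)) (locally l) ->
  filterlim f (at_right t) (locally l).
Proof.
  intros HD Hf P HP. specialize (Hf P HP).
  unfold filtermap, at_right, within in *.
  apply filter_imp with (2 := filter_and _ _ HD Hf). intros s [H1 H2] Hs. auto.
Qed.

Lemma locally_between (p q t : R) : p < t < q -> locally t (fun s => p < s < q).
Proof.
  intros H.
  apply (open_and _ _ (open_gt p) (open_lt q)). exact H.
Qed.

(** * The impulse points *)

(** The assumptions on the period and on the impulse points. *)

Record impulse_grid (T : R) (r : nat) (tau : Z -> R) : Prop := {
  grid_T : 0 < T;
  grid_r : (0 < r)%nat;
  grid_incr : forall i : Z, tau i < tau (i + 1)%Z;
  grid_per : forall i : Z, tau (i + Z.of_nat r)%Z = tau i + T;
  grid_first : 0 < tau 1%Z;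
  grid_last : tau (Z.of_nat r) < T }.

Section Grid.

Context (T : R) (r : nat) (tau : Z -> R) (G : impulse_grid T r tau).

Lemma tau_lt (i j : Z) : (i < j)%Z -> tau i < tau j.
Proof.
  intros H. replace j with (i + 1 + Z.of_nat (Z.to_nat (j - i - 1)))%Z by lia.
  induction (Z.to_nat (j - i - 1)) as [|n IH].
  - rewrite Z.add_0_r. apply G.
  - apply Rlt_trans with (1 := IH).
    replace (i + 1 + Z.of_nat (S n))%Z with (i + 1 + Z.of_nat n + 1)%Z by lia.
    apply G.
Qed.

Lemma tau_le (i j : Z) : (i <= j)%Z -> tau i <= tau j.
Proof.
  intros H. destruct (Z.eq_dec i j) as [->|E]; [lra|].
  apply Rlt_le, tau_lt. lia.
Qed.

Lemma tau_lt_inv (i j : Z) : tau i < tau j -> (i < j)%Z.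
Proof.
  intros H. destruct (Z_lt_le_dec i j) as [L|L]; [exact L|].
  apply tau_le in L. lra.
Qed.

Lemma tau_per_nat (i : Z) (k : nat) :
  tau (i + Z.of_nat k * Z.of_nat r)%Z = tau i + INR k * T.
Proof.
  induction k as [|k IH].
  - simpl. rewrite Z.add_0_r. ring.
  - replace (i + Z.of_nat (S k) * Z.of_nat r)%Z
      with (i + Z.of_nat k * Z.of_nat r + Z.of_nat r)%Z by lia.
    rewrite (grid_per _ _ _ G), IH, S_INR. ring.
Qed.

Lemma tau_per_Z (i k : Z) :
  tau (i + k * Z.of_nat r)%Z = tau i + IZR k * T.
Proof.
  destruct (Z_le_gt_dec 0 k) as [Hk|Hk].
  - rewrite <- (Z2Nat.id k Hk), tau_per_nat, <- INR_IZR_INZ. reflexivity.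
  - pose proof (tau_per_nat (i + k * Z.of_nat r) (Z.to_nat (- k))) as H.
    rewrite Z2Nat.id in H by lia.
    rewrite INR_IZR_INZ, Z2Nat.id, opp_IZR in H by lia.
    replace (i + k * Z.of_nat r + - k * Z.of_nat r)%Z with i in H by ring.
    lra.
Qed.

(** Every real lies in a half-open translate ]k T, (k+1) T] of the period. *)
Lemma period_cell (x : R) : exists k : Z, IZR k * T < x <= IZR (k + 1) * T.
Proof.
  pose proof (grid_T _ _ _ G) as HT.
  destruct (archimed (- (x / T))) as [H1 H2].
  exists (- up (- (x / T)))%Z.
  rewrite plus_IZR, opp_IZR.
  assert (Hx : x = x / T * T) by (field; lra).
  set (y := x / T) in *. clearbody y. subst x.
  split; [apply Rmult_lt_compat_r | apply Rmult_le_compat_r]; lra.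
Qed.

Lemma impulse_cell (t : R) : exists i : Z, tau i < t <= tau (i + 1)%Z.
Proof.
  destruct (period_cell (t - tau 0%Z)) as [k Hk].
  assert (H1 : tau (k * Z.of_nat r)%Z < t)
    by (pose proof (tau_per_Z 0 k) as E; simpl in E; lra).
  assert (H2 : t <= tau (k * Z.of_nat r + Z.of_nat r)%Z).
  { pose proof (tau_per_Z 0 (k + 1)) as E. simpl in E.
    replace ((k + 1) * Z.of_nat r)%Z with (k * Z.of_nat r + Z.of_nat r)%Z in E by ring.
    lra. }
  revert H2. generalize r at 2. intros n.
  induction n as [|n IH]; intros H2.
  - rewrite Z.add_0_r in H2. lra.
  - destruct (Rle_lt_dec t (tau (k * Z.of_nat r + Z.of_nat n)%Z)) as [L|L].
    + exact (IH L).
    + exists (k * Z.of_nat r + Z.of_nat n)%Z. split; [exact L|].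
      replace (k * Z.of_nat r + Z.of_nat n + 1)%Z
        with (k * Z.of_nat r + Z.of_nat (S n))%Z by lia.
      exact H2.
Qed.

Lemma impulse_cell_unique (i j : Z) (t : R) :
  tau i < t <= tau (i + 1)%Z -> tau j < t <= tau (j + 1)%Z -> i = j.
Proof.
  intros Hi Hj.
  assert (i < j + 1)%Z by (apply tau_lt_inv; lra).
  assert (j < i + 1)%Z by (apply tau_lt_inv; lra).
  lia.
Qed.

Lemma open_cell_not_impulse (i : Z) (t : R) :
  tau i < t < tau (i + 1)%Z -> ~ impulse tau t.
Proof.
  intros Ht [j ->].
  assert (i < j)%Z by (apply tau_lt_inv; lra).
  assert (j < i + 1)%Z by (apply tau_lt_inv; lra).
  lia.
Qed.

Lemma at_left_cell (i : Z) (t : R) :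
  tau i < t <= tau (i + 1)%Z -> at_left t (fun s => tau i < s < tau (i + 1)%Z).
Proof.
  intros Ht. assert (Hd : 0 < t - tau i) by lra.
  exists (mkposreal _ Hd). intros s Hs Hst.
  change (Rabs (s - t) < t - tau i) in Hs.
  apply Rabs_def2 in Hs. lra.
Qed.

Lemma at_right_cell (i : Z) (t : R) :
  tau i <= t < tau (i + 1)%Z -> at_right t (fun s => tau i < s < tau (i + 1)%Z).
Proof.
  intros Ht. assert (Hd : 0 < tau (i + 1)%Z - t) by lra.
  exists (mkposreal _ Hd). intros s Hs Hst.
  change (Rabs (s - t) < tau (i + 1)%Z - t) in Hs.
  apply Rabs_def2 in Hs. lra.
Qed.

Lemma at_left_not_impulse (t : R) : at_left t (fun s => ~ impulse tau s).
Proof.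
  destruct (impulse_cell t) as [i Hi].
  apply filter_imp with (2 := at_left_cell i t Hi).
  intros s. apply open_cell_not_impulse.
Qed.

Lemma right_cell (t : R) : exists i : Z, tau i <= t < tau (i + 1)%Z.
Proof.
  destruct (impulse_cell t) as [i [H1 H2]].
  destruct (Rle_lt_or_eq_dec _ _ H2) as [L|E].
  - exists i. lra.
  - exists (i + 1)%Z. pose proof (grid_incr _ _ _ G (i + 1)). lra.
Qed.

Lemma at_right_not_impulse (t : R) : at_right t (fun s => ~ impulse tau s).
Proof.
  destruct (right_cell t) as [i Hi].
  apply filter_imp with (2 := at_right_cell i t Hi).
  intros s. apply open_cell_not_impulse.
Qed.

Lemma not_impulse_cell (t : R) :
  ~ impulse tau t -> exists i : Z, tau i < t < tau (i + 1)%Z.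
Proof.
  intros Ht. destruct (impulse_cell t) as [i [H1 H2]].
  exists i. destruct (Rle_lt_or_eq_dec _ _ H2) as [L|E]; [lra|].
  destruct Ht. now exists (i + 1)%Z.
Qed.

Lemma locally_not_impulse (t : R) :
  ~ impulse tau t -> locally t (fun s => ~ impulse tau s).
Proof.
  intros Ht. destruct (not_impulse_cell t Ht) as [i Hi].
  apply filter_imp with (2 := locally_between _ _ _ Hi).
  intros s. apply open_cell_not_impulse.
Qed.

Lemma impulse_period (t : R) : impulse tau (t + T) <-> impulse tau t.
Proof.
  split; intros [i Hi].
  - exists (i - Z.of_nat r)%Z.
    pose proof (grid_per _ _ _ G (i - Z.of_nat r)) as H.
    replace (i - Z.of_nat r + Z.of_nat r)%Z with i in H by ring. lra.
  - exists (i + Z.of_nat r)%Z. rewrite (grid_per _ _ _ G). lra.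
Qed.

Lemma impulse_in_period (i : Z) : 0 <= tau i <= T -> index_1_r r i.
Proof.
  pose proof (grid_first _ _ _ G). pose proof (grid_last _ _ _ G).
  pose proof (grid_per _ _ _ G 0) as E0. pose proof (grid_per _ _ _ G 1) as E1.
  intros Hi. simpl in E0.
  assert (0 < i)%Z by (apply tau_lt_inv; lra).
  assert (i < 1 + Z.of_nat r)%Z by (apply tau_lt_inv; lra).
  unfold index_1_r. lia.
Qed.

Lemma index_in_period (i : Z) : index_1_r r i -> 0 < tau i < T.
Proof.
  intros [H1 H2]. pose proof (tau_le 1 i H1). pose proof (tau_le i _ H2).
  pose proof (grid_first _ _ _ G). pose proof (grid_last _ _ _ G). lra.
Qed.

Lemma PC_dom_iff (t : R) : PC_dom T r tau t <-> 0 <= t <= T /\ ~ impulse tau t.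
Proof.
  split; intros [H1 H2]; (split; [exact H1|]).
  - intros [i ->]. apply (H2 i); [|reflexivity]. now apply impulse_in_period.
  - intros i Hi ->. apply H2. now exists i.
Qed.

Lemma period_induction (P : R -> Prop) :
  (forall t, P t <-> P (t + T)) -> (forall t, 0 < t <= T -> P t) -> forall t, P t.
Proof.
  intros HP H0.
  assert (Hn : forall (n : nat) t, P t <-> P (t + INR n * T)).
  { induction n as [|n IH]; intros t.
    - simpl. now rewrite Rmult_0_l, Rplus_0_r.
    - rewrite (IH t), HP, S_INR. now replace (t + INR n * T + T)
        with (t + (INR n + 1) * T) by ring. }
  intros t. destruct (period_cell t) as [k Hk]. rewrite plus_IZR in Hk.
  assert (Hb : P (t - IZR k * T)) by (apply H0; lra).
  destruct (Z_le_gt_dec 0 k) as [L|L].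
  - apply (Hn (Z.to_nat k)) in Hb.
    rewrite INR_IZR_INZ, Z2Nat.id in Hb by lia.
    now replace (t - IZR k * T + IZR k * T) with t in Hb by ring.
  - apply (Hn (Z.to_nat (- k))).
    rewrite INR_IZR_INZ, Z2Nat.id, opp_IZR by lia.
    now replace (t + - IZR k * T) with (t - IZR k * T) by ring.
Qed.

End Grid.

(** * Regulated functions *)

(** Both one-sided limits exist everywhere; nothing is asked of the values. *)
Definition regulated (f : R -> R) : Prop :=
  forall t : R, (exists l : R, filterlim f (at_left t) (locally l)) /\
                (exists l : R, filterlim f (at_right t) (locally l)).

Lemma lim_bounded {X : Type} {F : (X -> Prop) -> Prop} {FF : Filter F}
  (f : X -> R) (l : R) :
  filterlim f F (locally l) -> F (fun x => Rabs (f x) <= Rabs l + 1).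
Proof.
  intros H. 
  apply (filter_imp (fun x => Rabs (f x - l) < 1)).
  - intros x Hx. pose proof (Rabs_triang (f x - l) l) as Ht.
    replace (f x - l + l) with (f x) in Ht by ring. lra.
  - apply (proj1 (filterlim_locally f l) H (mkposreal 1 Rlt_0_1)).
Qed.

(** The supremum of the points up to which [f] is bounded can be passed, by the
    one-sided limits there, unless it is [q]. *)
Lemma regulated_bounded (f : R -> R) (p q : R) :
  regulated f -> p <= q ->
  exists M : R, 0 <= M /\ forall t : R, p <= t <= q -> Rabs (f t) <= M.
Proof.
  intros Hf Hpq.
  set (E := fun s => p <= s <= q /\
                     exists M, 0 <= M /\ forall t, p <= t <= s -> Rabs (f t) <= M).
  assert (Ep : E p).
  { split; [lra|]. exists (Rabs (f p)). split; [apply Rabs_pos|].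
    intros t Ht. replace t with p by lra. lra. }
  destruct (completeness E) as [s [Hs1 Hs2]].
  { exists q. intros s [Hs _]. lra. }
  { now exists p. }
  assert (Hps : p <= s) by now apply Hs1.
  assert (Hsq : s <= q) by (apply Hs2; intros x [Hx _]; lra).
  destruct (Hf s) as [[l Hl] [m Hm]].
  apply lim_bounded in Hl. destruct Hl as [d Hd].
  apply lim_bounded in Hm. destruct Hm as [e He].
  (* the bound reaches a point within distance d to the left of s *)
  assert (Hx : exists x, E x /\ s - d < x).
  { destruct (Classical_Prop.classic (exists x, E x /\ s - d < x)) as [H|H]; [exact H|].
    exfalso. assert (s <= s - d); [|destruct d; simpl in *; lra].
    apply Hs2. intros x Hx. apply Rnot_lt_le. intros L. apply H. now exists x. }
  destruct Hx as [x [[Hx [M [HM0 HM]]] Hxs]].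
  set (M' := M + (Rabs l + 1) + (Rabs m + 1) + Rabs (f s)).
  pose proof (Rabs_pos l). pose proof (Rabs_pos m). pose proof (Rabs_pos (f s)).
  assert (Hball : forall t, p <= t < s + e -> Rabs (f t) <= M').
  { intros t Ht. unfold M'.
    destruct (Rle_lt_dec t x) as [L|L].
    - pose proof (HM t (conj (proj1 Ht) L)). lra.
    - destruct (Rtotal_order t s) as [L'|[->|L']].
      + assert (Rabs (f t) <= Rabs l + 1); [|lra].
        apply Hd; [|exact L']. change (Rabs (t - s) < d). apply Rabs_def1; lra.
      + lra.
      + assert (Rabs (f t) <= Rabs m + 1); [|lra].
        apply He; [|exact L']. change (Rabs (t - s) < e). apply Rabs_def1; lra. }
  destruct (Rle_lt_dec q s) as [L|L].
  - exists M'. split; [unfold M'; lra|]. intros t Ht. apply Hball. destruct e; simpl; lra.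
  - exfalso. 
    assert (Hy : E (Rmin q (s + e / 2))).
    { assert (p <= Rmin q (s + e / 2) <= q).
      { split; [apply Rmin_glb; destruct e; simpl in *; lra|apply Rmin_l]. }
      split; [easy|]. exists M'. split; [unfold M'; lra|].
      intros t Ht. apply Hball. pose proof (Rmin_r q (s + e / 2)).
      destruct e; simpl in *; lra. }
    apply Hs1 in Hy. revert Hy. destruct e as [e e0]; simpl.
    unfold Rmin. destruct (Rle_dec q (s + e / 2)); lra.
Qed.

(** [h] is any binary operation compatible with limits along every filter. *)
Lemma regulated_comp_2 (h : R -> R -> R) (f g : R -> R) :
  (forall (X : Type) (F : (X -> Prop) -> Prop) (FF : Filter F) (u v : X -> R) l m,
     filterlim u F (locally l) -> filterlim v F (locally m) ->
     filterlim (fun x => h (u x) (v x)) F (locally (h l m))) ->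
  regulated f -> regulated g -> regulated (fun t => h (f t) (g t)).
Proof.
  intros Hh Hf Hg t.
  destruct (Hf t) as [[l Hl] [l' Hl']]. destruct (Hg t) as [[m Hm] [m' Hm']].
  split; [exists (h l m)|exists (h l' m')]; apply Hh; try assumption;
    apply within_filter; apply locally_filter.
Qed.

Lemma regulated_comp (h f : R -> R) :
  (forall l, continuous h l) -> regulated f -> regulated (fun t => h (f t)).
Proof.
  intros Hh Hf t. destruct (Hf t) as [[l Hl] [l' Hl']].
  split; [exists (h l)|exists (h l')]; now apply lim_comp.
Qed.

(** * Piecewise continuous functions *)

(** Continuous off the impulse points, with one-sided limits everywhere. *)
Definition pw_continuous (tau : Z -> R) (f : R -> R) : Prop :=
  regulated f /\ forall t : R, ~ impulse tau t -> continuous f t.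

Lemma pw_continuous_plus (tau : Z -> R) (f g : R -> R) :
  pw_continuous tau f -> pw_continuous tau g ->
  pw_continuous tau (fun t => f t + g t).
Proof.
  intros [Hf Hf'] [Hg Hg']. split.
  - apply regulated_comp_2 with (2 := Hf) (3 := Hg). intros. now apply lim_plus.
  - intros t Ht. apply (lim_plus f g); [now apply Hf'|now apply Hg'].
Qed.

Lemma pw_continuous_mult (tau : Z -> R) (f g : R -> R) :
  pw_continuous tau f -> pw_continuous tau g ->
  pw_continuous tau (fun t => f t * g t).
Proof.
  intros [Hf Hf'] [Hg Hg']. split.
  - apply regulated_comp_2 with (2 := Hf) (3 := Hg). intros. now apply lim_mult.
  - intros t Ht. apply (lim_mult f g); [now apply Hf'|now apply Hg'].
Qed.

Lemma pw_continuous_comp (tau : Z -> R) (h f : R -> R) :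
  (forall l, continuous h l) -> pw_continuous tau f ->
  pw_continuous tau (fun t => h (f t)).
Proof.
  intros Hh [Hf Hf']. split.
  - now apply regulated_comp.
  - intros t Ht. apply (lim_comp h f); [apply Hh|now apply Hf'].
Qed.

Lemma regulated_ext (tau : Z -> R) (f g : R -> R) :
  (forall t, at_left t (fun s => f s = g s)) ->
  (forall t, at_right t (fun s => f s = g s)) ->
  regulated f -> regulated g.
Proof.
  intros HL HR Hf t. destruct (Hf t) as [[l Hl] [l' Hl']].
  split; [exists l|exists l'].
  - apply filterlim_ext_loc with (2 := Hl). apply HL.
  - apply filterlim_ext_loc with (2 := Hl'). apply HR.
Qed.

Lemma continuous_opp_R (l : R) : continuous Ropp l.
Proof. apply (continuous_opp (fun x : R => x)), continuous_id. Qed.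

Lemma continuous_pos_part (l : R) : continuous pos_part l.
Proof.
  apply continuous_ext with (f := fun x => (x + Rabs x) * / 2).
  - intros x. unfold pos_part, Rmax, Rabs.
    destruct (Rle_dec x 0); destruct (Rcase_abs x); lra.
  - apply (lim_mult (fun x => x + Rabs x) (fun _ => / 2)); [|apply filterlim_const].
    apply (lim_plus (fun x => x) Rabs); [apply filterlim_id|].
    apply continuous_Rabs.
Qed.

Lemma pw_continuous_ext (T : R) (r : nat) (tau : Z -> R)
  (G : impulse_grid T r tau) (f g : R -> R) :
  (forall t, ~ impulse tau t -> f t = g t) ->
  pw_continuous tau f -> pw_continuous tau g.
Proof.
  intros E [Hf Hc]. split.
  - apply (regulated_ext tau f g).
    + intros t. apply filter_imp with (2 := at_left_not_impulse T r tau G t). exact E.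
    + intros t. apply filter_imp with (2 := at_right_not_impulse T r tau G t). exact E.
    + exact Hf.
  - intros t Ht. apply continuous_ext_loc with (g := f).
    + apply filter_imp with (2 := locally_not_impulse T r tau G t Ht). exact E.
    + now apply Hc.
Qed.

(** * Piecewise differentiable functions *)

(** [f] has derivative [df] off the impulse points, is left continuous at
    [tau i], and has there the right-hand limit [j i]. *)
Definition pw_derive (tau : Z -> R) (f df : R -> R) (j : Z -> R) : Prop :=
  (forall t : R, ~ impulse tau t -> is_derive f t (df t)) /\
  (forall i : Z, filterlim f (at_left (tau i)) (locally (f (tau i))) /\
                 filterlim f (at_right (tau i)) (locally (j i))).

Section PwDerive.

Context (tau : Z -> R).

Lemma pw_derive_ext (f df df' : R -> R) (j j' : Z -> R) :
  (forall t, ~ impulse tau t -> df t = df' t) -> (forall i, j i = j' i) ->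
  pw_derive tau f df j -> pw_derive tau f df' j'.
Proof.
  intros Hd Hj [H1 H2]. split.
  - intros t Ht. rewrite <- Hd by exact Ht. now apply H1.
  - intros i. rewrite <- Hj. apply H2.
Qed.

Lemma pw_derive_const (k : R) : pw_derive tau (fun _ => k) (fun _ => 0) (fun _ => k).
Proof.
  split.
  - intros t _. apply (is_derive_const (K := R_AbsRing) (V := R_NormedModule)).
  - intros i. split; apply filterlim_const.
Qed.

Lemma pw_derive_id : pw_derive tau (fun t => t) (fun _ => 1) tau.
Proof.
  split.
  - intros t _. apply (is_derive_id (K := R_AbsRing)).
  - intros i. split; [apply (continuous_left (fun t => t))
                     |apply (continuous_right (fun t => t))]; apply continuous_id.
Qed.

Lemma pw_derive_plus (f df g dg : R -> R) (jf jg : Z -> R) :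
  pw_derive tau f df jf -> pw_derive tau g dg jg ->
  pw_derive tau (fun t => f t + g t) (fun t => df t + dg t) (fun i => jf i + jg i).
Proof.
  intros [Hf Lf] [Hg Lg]. split.
  - intros t Ht. apply (is_derive_plus f g); auto.
  - intros i. destruct (Lf i), (Lg i). split; now apply lim_plus.
Qed.

Lemma pw_derive_mult (f df g dg : R -> R) (jf jg : Z -> R) :
  pw_derive tau f df jf -> pw_derive tau g dg jg ->
  pw_derive tau (fun t => f t * g t) (fun t => df t * g t + f t * dg t)
    (fun i => jf i * jg i).
Proof.
  intros [Hf Lf] [Hg Lg]. split.
  - intros t Ht. apply (is_derive_mult f g); auto. exact Rmult_comm.
  - intros i. destruct (Lf i), (Lg i). split; now apply lim_mult.
Qed.

Lemma pw_derive_scal (k : R) (f df : R -> R) (j : Z -> R) :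
  pw_derive tau f df j ->
  pw_derive tau (fun t => k * f t) (fun t => k * df t) (fun i => k * j i).
Proof.
  intros H.
  apply pw_derive_ext with (3 := pw_derive_mult _ _ _ _ _ _ (pw_derive_const k) H);
    intros; ring.
Qed.

Lemma pw_derive_comp (h dh f df : R -> R) (j : Z -> R) :
  (forall l, is_derive h l (dh l)) -> pw_derive tau f df j ->
  pw_derive tau (fun t => h (f t)) (fun t => df t * dh (f t)) (fun i => h (j i)).
Proof.
  intros Hh [Hf Lf]. split.
  - intros t Ht. apply (is_derive_comp h f); auto.
  - assert (Hc : forall l, continuous h l)
      by (intros l; apply (ex_derive_continuous (K := R_AbsRing) h); now exists (dh l)).
    intros i. destruct (Lf i). split; now apply lim_comp.
Qed.

Lemma pw_derive_exp (f df : R -> R) (j : Z -> R) :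
  pw_derive tau f df j ->
  pw_derive tau (fun t => exp (f t)) (fun t => df t * exp (f t)) (fun i => exp (j i)).
Proof. apply (pw_derive_comp exp exp). apply is_derive_exp. Qed.

Lemma pw_derive_inv (f df : R -> R) (j : Z -> R) :
  (forall t, f t <> 0) -> (forall i, j i <> 0) -> pw_derive tau f df j ->
  pw_derive tau (fun t => / f t) (fun t => - df t / f t ^ 2) (fun i => / j i).
Proof.
  intros Hf0 Hj0 [Hf Lf]. split.
  - intros t Ht. apply is_derive_inv; auto.
  - intros i. destruct (Lf i).
    assert (Hc : forall l, l <> 0 -> continuous Rinv l).
    { intros l Hl. apply (ex_derive_continuous (K := R_AbsRing) Rinv).
      exists (- 1 / l ^ 2). apply (is_derive_inv (fun x => x)); [|exact Hl].
      apply (is_derive_id (K := R_AbsRing)). }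
    split; apply lim_comp; auto.
Qed.

Lemma pw_derive_continuous_at (f df : R -> R) (j : Z -> R) (t : R) :
  pw_derive tau f df j -> ~ impulse tau t -> continuous f t.
Proof.
  intros [Hf _] Ht. apply (ex_derive_continuous (K := R_AbsRing) f).
  exists (df t). now apply Hf.
Qed.

Lemma pw_derive_left (f df : R -> R) (j : Z -> R) (t : R) :
  pw_derive tau f df j -> filterlim f (at_left t) (locally (f t)).
Proof.
  intros H. destruct (Classical_Prop.classic (impulse tau t)) as [[i ->]|Ht].
  - apply H.
  - apply continuous_left. now apply (pw_derive_continuous_at f df j).
Qed.

Lemma pw_derive_regulated (f df : R -> R) (j : Z -> R) :
  pw_derive tau f df j -> regulated f.
Proof.
  intros H t. split; [exists (f t); now apply (pw_derive_left f df j)|].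
  destruct (Classical_Prop.classic (impulse tau t)) as [[i ->]|Ht].
  - exists (j i). apply H.
  - exists (f t). apply continuous_right. now apply (pw_derive_continuous_at f df j).
Qed.

Lemma pw_derive_continuous (f df : R -> R) :
  pw_derive tau f df (fun i => f (tau i)) -> forall t, continuous f t.
Proof.
  intros H t. destruct (Classical_Prop.classic (impulse tau t)) as [[i ->]|Ht].
  - now apply continuous_two_sided; apply H.
  - now apply (pw_derive_continuous_at f df (fun i => f (tau i))).
Qed.

End PwDerive.

Section Calculus.

Context (T : R) (r : nat) (tau : Z -> R) (G : impulse_grid T r tau).

Lemma pw_derive_shift (f df : R -> R) (j : Z -> R) :
  pw_derive tau f df j ->
  pw_derive tau (fun t => f (t + T)) (fun t => df (t + T))
    (fun i => j (i + Z.of_nat r)%Z).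
Proof.
  intros [Hf Lf]. split.
  - intros t Ht. apply is_derive_shift, Hf.
    now rewrite (impulse_period _ _ _ G).
  - intros i. destruct (Lf (i + Z.of_nat r)%Z) as [L1 L2].
    rewrite (grid_per _ _ _ G) in L1, L2. split.
    + now apply lim_left_shift.
    + now apply lim_right_shift.
Qed.

Lemma monotone_open_cell (f df : R -> R) (j : Z -> R) (i : Z) (s t : R) :
  pw_derive tau f df j -> tau i < s -> s <= t -> t < tau (i + 1)%Z ->
  (forall x, ~ impulse tau x -> s <= x <= t -> df x <= 0) -> f t <= f s.
Proof.
  intros H Hs Hst Ht Hneg.
  assert (Hni : forall x, s <= x <= t -> ~ impulse tau x).
  { intros x Hx. apply (open_cell_not_impulse T r tau G i). lra. }
  destruct (MVT_gen f s t df) as [x [Hx E]].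
  - intros x Hx. rewrite Rmin_left, Rmax_right in Hx by lra.
    apply H, Hni. lra.
  - intros x Hx. rewrite Rmin_left, Rmax_right in Hx by lra.
    apply continuity_pt_filterlim. apply (pw_derive_continuous_at tau f df j x H).
    apply Hni. lra.
  - rewrite Rmin_left, Rmax_right in Hx by lra.
    assert (df x * (t - s) <= 0 * (t - s)); [|lra].
    apply Rmult_le_compat_r; [lra|]. apply Hneg; [now apply Hni|lra].
Qed.

Lemma monotone_cell (f df : R -> R) (j : Z -> R) (i : Z) (s t : R) :
  pw_derive tau f df j -> tau i < s -> s <= t -> t <= tau (i + 1)%Z ->
  (forall x, ~ impulse tau x -> s <= x <= t -> df x <= 0) -> f t <= f s.
Proof.
  intros H Hs Hst Ht Hneg.
  destruct (Req_dec s t) as [->|E]; [lra|].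
  apply (lim_le_const (F := at_left t) f); [|now apply (pw_derive_left tau f df j)].
  apply filter_imp with (2 := at_left_open s t ltac:(lra)).
  intros x Hx. apply (monotone_open_cell f df j i); try lra; [exact H|].
  intros y Hy Hy'. apply Hneg; [exact Hy|lra].
Qed.

(** A function with nonpositive derivative and no upward jump is
    nonincreasing.  An impulse point at the right end does not matter, since
    functions are left continuous. *)
Lemma pw_derive_nonincreasing (f df : R -> R) (j : Z -> R) (p q : R) :
  pw_derive tau f df j -> p <= q ->
  (forall t, ~ impulse tau t -> p <= t <= q -> df t <= 0) ->
  (forall i, p <= tau i < q -> j i <= f (tau i)) ->
  f q <= f p.
Proof.
  intros H Hpq Hneg Hjump.
  destruct (impulse_cell T r tau G p) as [i Hi].
  destruct (impulse_cell T r tau G q) as [k Hk].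
  assert (Hik : (i < k + 1)%Z) by (apply (tau_lt_inv T r tau G); lra).
  replace k with (i + Z.of_nat (Z.to_nat (k - i)))%Z in Hk by lia.
  clear Hik. revert q Hpq Hneg Hjump Hk.
  induction (Z.to_nat (k - i)) as [|n IH]; intros q Hpq Hneg Hjump Hk.
  - rewrite Z.add_0_r in Hk. apply (monotone_cell f df j i); tauto || lra.
  - replace (i + Z.of_nat (S n))%Z with (i + Z.of_nat n + 1)%Z in Hk by lia.
    set (m := (i + Z.of_nat n + 1)%Z) in *.
    assert (Hm : tau (i + 1)%Z <= tau m) by (apply (tau_le T r tau G); lia).
    assert (Hpm : p <= tau m) by lra.
    apply Rle_trans with (f (tau m)).
    + apply Rle_trans with (j m); [|apply Hjump; lra].
      apply (lim_ge_const (F := at_right (tau m)) f); [|apply H].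
      apply filter_imp with (2 := at_right_open (tau m) q ltac:(lra)).
      intros x Hx. apply (monotone_cell f df j m); try lra; [exact H|].
      intros y Hy Hy'. apply Hneg; [exact Hy|lra].
    + apply IH; [exact Hpm| | |].
      * intros t Ht Ht'. apply Hneg; [exact Ht|lra].
      * intros l Hl. apply Hjump. lra.
      * split; [|unfold m; lra]. apply (tau_lt T r tau G). unfold m. lia.
Qed.

Lemma pw_derive_constant (f df : R -> R) (j : Z -> R) :
  pw_derive tau f df j ->
  (forall t, ~ impulse tau t -> df t = 0) -> (forall i, j i = f (tau i)) ->
  forall s t, f s = f t.
Proof.
  intros H Hd Hj.
  assert (Hle : forall s t, s <= t -> f s = f t).
  { intros s t Hst. apply Rle_antisym.
    - apply (pw_derive_scal tau (-1)) in H.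
      assert (-1 * f t <= -1 * f s); [|lra].
      apply (pw_derive_nonincreasing _ _ _ s t H Hst).
      + intros x Hx _. rewrite Hd by exact Hx. lra.
      + intros i _. rewrite Hj. lra.
    - apply (pw_derive_nonincreasing _ _ _ s t H Hst).
      + intros x Hx _. rewrite Hd by exact Hx. lra.
      + intros i _. rewrite Hj. lra. }
  intros s t. destruct (Rle_lt_dec s t) as [L|L]; [now apply Hle|].
  symmetry. apply Hle. lra.
Qed.

(** * Antiderivatives *)

(** On each cell [tau i, tau (i+1)] the function agrees, in the interior, with a
    continuous one. *)
Lemma pw_continuous_ex_RInt_le (f : R -> R) (p q : R) :
  pw_continuous tau f -> p <= q -> ex_RInt f p q.
Proof.
  intros [Hf Hc] Hpq.
  assert (Hcell : forall i s t, tau i <= s -> s <= t -> t <= tau (i + 1)%Z ->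
                                ex_RInt f s t).
  { intros i s t Hs Hst Ht.
    destruct (Req_dec s t) as [->|E]; [apply ex_RInt_point|].
    destruct (Hf s) as [_ [la Hla]]. destruct (Hf t) as [[lb Hlb] _].
    destruct (C0_extension_lt f la lb s t ltac:(lra)) as [g [Hg [Hfg _]]].
    - intros x Hx. apply Hc, (open_cell_not_impulse T r tau G i). lra.
    - exact Hla.
    - exact Hlb.
    - apply ex_RInt_ext with g.
      + intros x Hx. rewrite Rmin_left, Rmax_right in Hx by lra. now apply Hfg.
      + apply (ex_RInt_continuous (V := R_CompleteNormedModule)). intros z _. apply Hg. }
  destruct (impulse_cell T r tau G p) as [i Hi].
  destruct (impulse_cell T r tau G q) as [k Hk].
  assert (Hik : (i < k + 1)%Z) by (apply (tau_lt_inv T r tau G); lra).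
  replace k with (i + Z.of_nat (Z.to_nat (k - i)))%Z in Hk by lia.
  clear Hik. revert q Hpq Hk.
  induction (Z.to_nat (k - i)) as [|n IH]; intros q Hpq Hk.
  - rewrite Z.add_0_r in Hk. apply (Hcell i); lra.
  - replace (i + Z.of_nat (S n))%Z with (i + Z.of_nat n + 1)%Z in Hk by lia.
    set (m := (i + Z.of_nat n + 1)%Z) in *.
    assert (Hm : tau (i + 1)%Z <= tau m) by (apply (tau_le T r tau G); lia).
    apply ex_RInt_Chasles with (tau m).
    + apply IH; [lra|]. split; [|unfold m; lra].
      apply (tau_lt T r tau G). unfold m. lia.
    + apply (Hcell m); lra.
Qed.

Lemma pw_continuous_ex_RInt (f : R -> R) (p q : R) :
  pw_continuous tau f -> ex_RInt f p q.
Proof.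
  intros Hf. destruct (Rle_lt_dec p q) as [L|L].
  - now apply pw_continuous_ex_RInt_le.
  - apply ex_RInt_swap, pw_continuous_ex_RInt_le; [exact Hf|lra].
Qed.

Lemma antiderivative_pw_derive (f : R -> R) :
  pw_continuous tau f ->
  pw_derive tau (RInt f 0) f (fun i => RInt f 0 (tau i)).
Proof.
  intros Hf.
  assert (Hint : forall t, locally t (fun z => is_RInt f 0 z (RInt f 0 z))).
  { intros t. apply filter_forall. intros z.
    apply (RInt_correct (V := R_CompleteNormedModule)).
    now apply pw_continuous_ex_RInt. }
  assert (Hcont : forall t, continuous (RInt f 0) t).
  { intros t. exact (continuous_RInt_1 f 0 t _ (Hint t)). }
  split.
  - intros t Ht. apply (is_derive_RInt f _ 0 t (Hint t)). now apply Hf.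
  - intros i. split; [apply continuous_left|apply continuous_right]; apply Hcont.
Qed.

(** Periodicity off the impulse points. *)
Definition periodic (f : R -> R) : Prop :=
  forall t : R, ~ impulse tau t -> f (t + T) = f t.

Lemma antiderivative_period (f : R -> R) :
  pw_continuous tau f -> periodic f ->
  forall t, RInt f 0 (t + T) = RInt f 0 t + RInt f 0 T.
Proof.
  intros Hf Hper t.
  pose proof (antiderivative_pw_derive f Hf) as H.
  pose proof (pw_derive_plus tau _ _ _ _ _ _ (pw_derive_shift _ _ _ H)
                (pw_derive_scal tau (-1) _ _ _ H)) as H1.
  assert (E : RInt f 0 (t + T) + -1 * RInt f 0 t = RInt f 0 (0 + T) + -1 * RInt f 0 0).
  { apply (pw_derive_constant _ _ _ H1).
    - intros s Hs. simpl. rewrite Hper by exact Hs. ring.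
    - intros i. simpl. rewrite (grid_per _ _ _ G). ring. }
  rewrite Rplus_0_l in E. rewrite RInt_point in E. unfold zero in E; simpl in E. lra.
Qed.

(** * Step functions *)

(** The index [i] of the cell ]tau i, tau (i+1)] that contains [t].  The cells
    are closed on the right, so that step functions are left continuous. *)
Definition cell_index (t : R) : Z :=
  proj1_sig (constructive_indefinite_description _ (impulse_cell T r tau G t)).

Lemma cell_index_spec (t : R) :
  tau (cell_index t) < t <= tau (cell_index t + 1)%Z.
Proof.
  unfold cell_index. now destruct (constructive_indefinite_description _ _).
Qed.

Lemma cell_index_eq (i : Z) (t : R) :
  tau i < t <= tau (i + 1)%Z -> cell_index t = i.
Proof.
  intros H. apply (impulse_cell_unique T r tau G _ _ t); [apply cell_index_spec|exact H].
Qed.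

Lemma cell_index_period (t : R) :
  cell_index (t + T) = (cell_index t + Z.of_nat r)%Z.
Proof.
  apply cell_index_eq. pose proof (cell_index_spec t).
  replace (cell_index t + Z.of_nat r + 1)%Z with (cell_index t + 1 + Z.of_nat r)%Z by ring.
  rewrite !(grid_per _ _ _ G). lra.
Qed.

Lemma cell_index_tau (i : Z) : cell_index (tau i) = (i - 1)%Z.
Proof.
  apply cell_index_eq. replace (i - 1 + 1)%Z with i by ring. split; [|lra].
  apply (tau_lt T r tau G). lia.
Qed.

(** The step function with value [sigma i] on ]tau i, tau (i+1)]. *)
Definition step (sigma : Z -> R) (t : R) : R := sigma (cell_index t).

Lemma step_pw_derive (sigma : Z -> R) :
  pw_derive tau (step sigma) (fun _ => 0) sigma.
Proof.
  split.
  - intros t Ht. destruct (not_impulse_cell T r tau G t Ht) as [i Hi].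
    apply is_derive_ext_loc with (f := fun _ => sigma i).
    + apply filter_imp with (2 := locally_between _ _ _ Hi).
      intros s Hs. unfold step. rewrite (cell_index_eq i); [reflexivity|lra].
    + apply (is_derive_const (K := R_AbsRing) (V := R_NormedModule)).
  - intros i. split.
    + apply filterlim_ext_loc with (f := fun _ => sigma (i - 1)%Z).
      * assert (Hi : tau (i - 1)%Z < tau i <= tau (i - 1 + 1)%Z).
        { replace (i - 1 + 1)%Z with i by ring. split; [|lra].
          apply (tau_lt T r tau G). lia. }
        apply filter_imp with (2 := at_left_cell tau (i - 1) (tau i) Hi).
        intros s Hs. unfold step. rewrite (cell_index_eq (i - 1)); [reflexivity|lra].
      * unfold step. rewrite cell_index_tau. apply filterlim_const.
    + apply filterlim_ext_loc with (f := fun _ => sigma i); [|apply filterlim_const].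
      assert (Hi : tau i <= tau i < tau (i + 1)%Z) by (split; [lra|apply G]).
      apply filter_imp with (2 := at_right_cell tau i (tau i) Hi).
      intros s Hs. unfold step. rewrite (cell_index_eq i); [reflexivity|lra].
Qed.

End Calculus.

(** Two-sided recursion over the integers; [k i] inverts [h i], which allows
    the recursion to run downwards from 0. *)
Lemma Z_recursion (h k : Z -> R -> R) (x0 : R) :
  (forall i x, h i (k i x) = x) ->
  exists sigma : Z -> R, sigma 0%Z = x0 /\
    forall i, sigma i = h i (sigma (i - 1)%Z).
Proof.
  intros Hhk.
  set (up := fix up (n : nat) := match n with
             | O => x0 | S n => h (Z.of_nat (S n)) (up n) end).
  set (down := fix down (n : nat) := match n with
               | O => x0 | S n => k (- Z.of_nat n)%Z (down n) end).
  exists (fun i => if Z_le_gt_dec 0 i then up (Z.to_nat i) else down (Z.to_nat (- i))).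
  split.
  - reflexivity.
  - intros i. destruct (Z_le_gt_dec 0 i) as [L|L].
    + destruct (Z_le_gt_dec 0 (i - 1)) as [L'|L'].
      * replace (Z.to_nat i) with (S (Z.to_nat (i - 1))) by lia. cbn -[Z.of_nat].
        f_equal. lia.
      * replace i with 0%Z by lia. simpl. now rewrite Hhk.
    + destruct (Z_le_gt_dec 0 (i - 1)) as [L'|L']; [lia|].
      replace (Z.to_nat (- (i - 1))) with (S (Z.to_nat (- i))) by lia. cbn -[Z.of_nat].
      replace (- Z.of_nat (Z.to_nat (- i)))%Z with i by lia. now rewrite Hhk.
Qed.

(** [sigma i] is the sum of [g 1], ..., [g i], extended to negative [i].  As a
    [step] function it jumps by [g i] at [tau i]. *)
Lemma Z_sum (g : Z -> R) :
  exists sigma : Z -> R, sigma 0%Z = 0 /\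
    forall i, sigma i = sigma (i - 1)%Z + g i.
Proof. apply (Z_recursion (fun i x => x + g i) (fun i x => x - g i)). intros. ring. Qed.

(** The multiplicative analogue of [Z_sum]. *)
Lemma Z_prod (g : Z -> R) :
  (forall i, g i <> 0) ->
  exists pi : Z -> R, pi 0%Z = 1 /\
    forall i, pi i = pi (i - 1)%Z * g i.
Proof.
  intros Hg. apply (Z_recursion (fun i x => x * g i) (fun i x => x / g i)).
  intros. now field.
Qed.

Lemma Z_sum_sum_n_m (g sigma : Z -> R) (r : nat) :
  (0 < r)%nat -> sigma 0%Z = 0 -> (forall i, sigma i = sigma (i - 1)%Z + g i) ->
  sum_n_m (fun i : nat => g (Z.of_nat i)) 1 r = sigma (Z.of_nat r).
Proof.
  intros Hr H0 Hs. induction r as [|r IH]; [lia|].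
  destruct r as [|r].
  - rewrite sum_n_n, (Hs (Z.of_nat 1)). simpl. rewrite H0. ring.
  - rewrite sum_n_Sm by lia. rewrite IH by lia.
    rewrite (Hs (Z.of_nat (S (S r)))).
    replace (Z.of_nat (S (S r)) - 1)%Z with (Z.of_nat (S r)) by lia. reflexivity.
Qed.

Lemma Z_prod_prod_f_R0 (g pi : Z -> R) (r : nat) :
  (0 < r)%nat -> pi 0%Z = 1 -> (forall i, pi i = pi (i - 1)%Z * g i) ->
  prod_f_R0 (fun k : nat => g (Z.of_nat (S k)) ^ 2) (r - 1) = pi (Z.of_nat r) ^ 2.
Proof.
  intros Hr H0 Hp. induction r as [|r IH]; [lia|].
  destruct r as [|r].
  - simpl prod_f_R0. rewrite (Hp (Z.of_nat 1)). simpl. rewrite H0. ring.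
  - replace (S (S r) - 1)%nat with (S (S r - 1))%nat by lia.
    cbn [prod_f_R0]. rewrite IH by lia.
    rewrite (Hp (Z.of_nat (S (S r)))).
    replace (S (S r - 1)) with (S r) by lia.
    replace (Z.of_nat (S (S r)) - 1)%Z with (Z.of_nat (S r)) by lia. ring.
Qed.

Section Period.

Context (r : nat).

Lemma Z_sum_period (g sigma : Z -> R) :
  sigma 0%Z = 0 -> (forall i, sigma i = sigma (i - 1)%Z + g i) ->
  (forall i, g (i + Z.of_nat r)%Z = g i) ->
  forall i, sigma (i + Z.of_nat r)%Z = sigma i + sigma (Z.of_nat r).
Proof.
  intros H0 Hs Hg i.
  assert (E : forall i, sigma (i + Z.of_nat r)%Z - sigma i =
                        sigma (i - 1 + Z.of_nat r)%Z - sigma (i - 1)%Z).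
  { intros j. rewrite (Hs j), (Hs (j + Z.of_nat r)%Z), Hg.
    replace (j + Z.of_nat r - 1)%Z with (j - 1 + Z.of_nat r)%Z by ring. ring. }
  assert (E' : sigma (i + Z.of_nat r)%Z - sigma i = sigma (Z.of_nat r)); [|lra].
  revert i. apply Z.bi_induction.
  - now intros x y ->.
  - rewrite H0, Z.add_0_l. ring.
  - intros n. rewrite (E (Z.succ n)). replace (Z.succ n - 1)%Z with n by lia. tauto.
Qed.

Lemma Z_prod_period (g pi : Z -> R) :
  pi 0%Z = 1 -> (forall i, pi i = pi (i - 1)%Z * g i) -> (forall i, g i <> 0) ->
  (forall i, g (i + Z.of_nat r)%Z = g i) ->
  forall i, pi (i + Z.of_nat r)%Z = pi (Z.of_nat r) * pi i.
Proof.
  intros H0 Hp Hg0 Hg. apply Z.bi_induction.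
  - now intros x y ->.
  - rewrite H0, Z.add_0_l. ring.
  - intros n. rewrite (Hp (Z.succ n)), (Hp (Z.succ n + Z.of_nat r)%Z), Hg.
    replace (Z.succ n + Z.of_nat r - 1)%Z with (n + Z.of_nat r)%Z by lia.
    replace (Z.succ n - 1)%Z with n by lia. rewrite <- Rmult_assoc.
    split; [now intros ->|]. intros E. apply Rmult_eq_reg_r with (2 := Hg0 (Z.succ n)). exact E.
Qed.

Lemma Z_prod_neq0 (g pi : Z -> R) :
  pi 0%Z = 1 -> (forall i, pi i = pi (i - 1)%Z * g i) -> (forall i, g i <> 0) ->
  forall i, pi i <> 0.
Proof.
  intros H0 Hp Hg0. apply Z.bi_induction.
  - now intros x y ->.
  - rewrite H0. lra.
  - intros n. rewrite (Hp (Z.succ n)). replace (Z.succ n - 1)%Z with n by lia.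
    pose proof (Hg0 (Z.succ n)). split; intros H' E.
    + apply Rmult_integral in E. tauto.
    + apply H'. rewrite E. ring.
Qed.

Lemma Z_prod_pos (g pi : Z -> R) :
  pi 0%Z = 1 -> (forall i, pi i = pi (i - 1)%Z * g i) -> (forall i, 0 < g i) ->
  forall i, 0 < pi i.
Proof.
  intros H0 Hp Hg0. apply Z.bi_induction.
  - now intros x y ->.
  - rewrite H0. lra.
  - intros n. rewrite (Hp (Z.succ n)). replace (Z.succ n - 1)%Z with n by lia.
    pose proof (Hg0 (Z.succ n)). split; intros H'.
    + now apply Rmult_lt_0_compat.
    + apply Rmult_lt_reg_r with (1 := H). lra.
Qed.

End Period.

(** * Pointwise inequalities *)

Lemma exp_le (x y : R) : x <= y -> exp x <= exp y.
Proof.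
  intros H. destruct (Rle_lt_or_eq_dec _ _ H) as [L| ->]; [|lra].
  now apply Rlt_le, exp_increasing.
Qed.

Lemma pos_part_ge0 (x : R) : 0 <= pos_part x.
Proof. apply Rmax_r. Qed.

Lemma pos_part_ge (x : R) : x <= pos_part x.
Proof. apply Rmax_l. Qed.

Lemma mult_pos_part_le (x p q : R) : 0 <= p -> p <= q -> x * p <= q * pos_part x.
Proof.
  intros Hp Hpq. pose proof (pos_part_ge x). pose proof (pos_part_ge0 x). nra.
Qed.

(** The derivative of the energy [y ^ 2 + v ^ 2] along the system is at most a
    multiple of the energy, in absolute value. *)
Lemma energy_growth (ka kb kc a0 b0 c0 y v : R) :
  - ka <= a0 <= ka -> - kb <= b0 <= kb -> - kc <= c0 <= kc ->
  - ((2 * ka + kb + kc) * (y * y + v * v)) <=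
    ((a0 * y + b0 * v) * y + y * (a0 * y + b0 * v)) +
    ((- c0 * y - a0 * v) * v + v * (- c0 * y - a0 * v)) <=
  (2 * ka + kb + kc) * (y * y + v * v).
Proof.
  intros Ha0 Hb0 Hc0.
  pose proof (Rle_0_sqr y). pose proof (Rle_0_sqr v).
  pose proof (Rle_0_sqr (y + v)). pose proof (Rle_0_sqr (y - v)).
  unfold Rsqr in *.
  assert (P1 : 0 <= (ka - a0) * (y * y)) by (apply Rmult_le_pos; lra).
  assert (P2 : 0 <= (ka + a0) * (y * y)) by (apply Rmult_le_pos; lra).
  assert (P3 : 0 <= (ka - a0) * (v * v)) by (apply Rmult_le_pos; lra).
  assert (P4 : 0 <= (ka + a0) * (v * v)) by (apply Rmult_le_pos; lra).
  assert (P5 : 0 <= (kb - b0) * ((y + v) * (y + v))) by (apply Rmult_le_pos; lra).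
  assert (P6 : 0 <= (kb + b0) * ((y + v) * (y + v))) by (apply Rmult_le_pos; lra).
  assert (P7 : 0 <= (kb - b0) * ((y - v) * (y - v))) by (apply Rmult_le_pos; lra).
  assert (P8 : 0 <= (kb + b0) * ((y - v) * (y - v))) by (apply Rmult_le_pos; lra).
  assert (Q5 : 0 <= (kc - c0) * ((y + v) * (y + v))) by (apply Rmult_le_pos; lra).
  assert (Q6 : 0 <= (kc + c0) * ((y + v) * (y + v))) by (apply Rmult_le_pos; lra).
  assert (Q7 : 0 <= (kc - c0) * ((y - v) * (y - v))) by (apply Rmult_le_pos; lra).
  assert (Q8 : 0 <= (kc + c0) * ((y - v) * (y - v))) by (apply Rmult_le_pos; lra).
  split; lra.
Qed.

Lemma energy_jump (g y v : R) :
  y * y + (v - g * y) * (v - g * y) <= (2 + 2 * g ^ 2) * (y * y + v * v).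
Proof.
  pose proof (Rle_0_sqr y). pose proof (Rle_0_sqr (v + g * y)).
  pose proof (Rle_0_sqr (g * v)). unfold Rsqr in *. nra.
Qed.

(** The first two terms are the derivatives of [eps * e * y], with
    [e = exp (- int a)], and of [- lam / 2 * y * v]; completing the square in [v]
    bounds them by the derivatives of the integrals of [b] and [pos_part c]. *)
Lemma lyapunov_slope (eps lam e K1 N b0 c0 a0 y v : R) :
  eps * eps = 1 -> 0 < lam -> 0 < b0 -> e * e <= K1 -> y * y <= N ->
  eps * (e * b0 * v)
  - lam / 2 * ((a0 * y + b0 * v) * v + y * (- c0 * y - a0 * v))
  - K1 / (2 * lam) * b0 - lam / 2 * N * pos_part c0 <= 0.
Proof.
  intros He Hlam Hb0 HK HN.
  pose proof (mult_pos_part_le c0 (y * y) N (Rle_0_sqr y) HN) as Hc0.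
  assert (H1 : 0 <= lam / 2 * (N * pos_part c0 - c0 * (y * y)))
    by (apply Rmult_le_pos; lra).
  assert (H2 : 0 <= / (2 * lam) * b0 * (K1 - e * e)).
  { apply Rmult_le_pos; [|lra]. apply Rmult_le_pos; [|lra].
    apply Rlt_le, Rinv_0_lt_compat. lra. }
  assert (H3 : 0 <= lam / 2 * b0 * ((v - eps * e / lam) * (v - eps * e / lam))).
  { apply Rmult_le_pos; [|apply Rle_0_sqr]. apply Rmult_le_pos; lra. }
  assert (E : lam / 2 * b0 * ((v - eps * e / lam) * (v - eps * e / lam)) =
    lam / 2 * b0 * (v * v) - eps * (e * b0 * v) + (eps * eps) * / (2 * lam) * b0 * (e * e))
    by (field; lra).
  rewrite E, He in H3. change (K1 / (2 * lam)) with (K1 * / (2 * lam)).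
  lra.
Qed.

(** The counterpart of [lyapunov_slope] for the jump of [y * v] at an impulse point. *)
Lemma lyapunov_jump (lam g N y v : R) :
  0 < lam -> y * y <= N ->
  - (lam / 2) * (y * (v - g * y)) - lam / 2 * N * pos_part g <= - (lam / 2) * (y * v).
Proof.
  intros Hlam HN. pose proof (mult_pos_part_le g (y * y) N (Rle_0_sqr y) HN) as H.
  assert (0 <= lam / 2 * (N * pos_part g - g * (y * y))) by (apply Rmult_le_pos; lra).
  lra.
Qed.

(** Take [mu = X / 2] if [X] is positive; [X = 0] is excluded by a small [mu]. *)
Lemma product_ge_four (X Y : R) :
  0 <= X -> (forall mu, 0 < mu -> 2 <= X / (2 * mu) + mu / 2 * Y) -> 4 <= X * Y.
Proof.
  intros HX H. destruct (Rle_lt_or_eq_dec _ _ HX) as [L|E].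
  - pose proof (H (X / 2) ltac:(lra)) as H'.
    replace (X / (2 * (X / 2))) with 1 in H' by (field; lra). lra.
  - exfalso. subst X.
    pose proof (Rabs_pos Y). pose proof (Rle_abs Y).
    assert (Hmu : 0 < / (Rabs Y + 1)) by (apply Rinv_0_lt_compat; lra).
    pose proof (H _ Hmu) as H'. unfold Rdiv in H'. rewrite Rmult_0_l in H'.
    assert (/ (Rabs Y + 1) * Y <= / (Rabs Y + 1) * (Rabs Y + 1))
      by (apply Rmult_le_compat_l; lra).
    rewrite Rinv_l in H2 by lra. lra.
Qed.

(** * The normalized system *)

Section Normalized.

Context (T : R) (r : nat) (tau : Z -> R) (G : impulse_grid T r tau).
Context (a b c : R -> R) (gamma : Z -> R).
Context (Ha : pw_continuous tau a) (Hb : pw_continuous tau b)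
  (Hc : pw_continuous tau c) (Hab : pw_continuous tau (fun t => a t / b t)).
Context (Ha_per : periodic T tau a) (Hb_per : periodic T tau b)
  (Hc_per : periodic T tau c).
Context (Hgamma_per : forall i : Z, gamma (i + Z.of_nat r)%Z = gamma i).
Context (Hb_pos : forall t : R, ~ impulse tau t -> 0 < b t).

(** Solutions of the system with [alpha i = 1] and [beta i = gamma i]; the
    values at the impulse points are the left-hand limits, and [y] is
    continuous. *)
Definition normalized_solution (y v : R -> R) : Prop :=
  pw_derive tau y (fun t => a t * y t + b t * v t) (fun i => y (tau i)) /\
  pw_derive tau v (fun t => - c t * y t - a t * v t)
    (fun i => v (tau i) - gamma i * y (tau i)).

Lemma normalized_solution_combination (k : R) (y1 v1 y2 v2 : R -> R) :
  normalized_solution y1 v1 -> normalized_solution y2 v2 ->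
  normalized_solution (fun t => y1 t + k * y2 t) (fun t => v1 t + k * v2 t).
Proof.
  intros [H1 H1'] [H2 H2'].
  split; (eapply pw_derive_ext;
    [| |apply (pw_derive_plus tau); [eassumption|apply pw_derive_scal; eassumption]]);
    intros; simpl; ring.
Qed.

Lemma normalized_solution_shift (y v : R -> R) :
  normalized_solution y v ->
  normalized_solution (fun t => y (t + T)) (fun t => v (t + T)).
Proof.
  intros [H1 H2].
  split; (eapply pw_derive_ext; [| |apply (pw_derive_shift T r tau G); eassumption]);
    cbv beta.
  - intros t Ht. now rewrite Ha_per, Hb_per.
  - intros i. now rewrite (grid_per _ _ _ G).
  - intros t Ht. now rewrite Ha_per, Hc_per.
  - intros i. now rewrite (grid_per _ _ _ G), Hgamma_per.
Qed.

Lemma wronskian_constant (y1 v1 y2 v2 : R -> R) :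
  normalized_solution y1 v1 -> normalized_solution y2 v2 ->
  forall s t, y1 s * v2 s - y2 s * v1 s = y1 t * v2 t - y2 t * v1 t.
Proof.
  intros [H1 H1'] [H2 H2'] s t.
  pose proof (pw_derive_plus tau _ _ _ _ _ _ (pw_derive_mult tau _ _ _ _ _ _ H1 H2')
    (pw_derive_scal tau (-1) _ _ _ (pw_derive_mult tau _ _ _ _ _ _ H2 H1'))) as H.
  assert (E : y1 s * v2 s + -1 * (y2 s * v1 s) = y1 t * v2 t + -1 * (y2 t * v1 t));
    [|lra].
  apply (pw_derive_constant T r tau G _ _ _ H); intros; simpl; ring.
Qed.

Lemma periodic_bounded (f : R -> R) :
  pw_continuous tau f -> periodic T tau f ->
  exists K, 0 <= K /\ forall t, ~ impulse tau t -> - K <= f t <= K.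
Proof.
  intros Hf Hper. pose proof (grid_T _ _ _ G).
  destruct (regulated_bounded f 0 T) as [K [HK0 HK]]; [apply Hf|lra|].
  exists K. split; [exact HK0|].
  apply (period_induction T r tau G (fun t => ~ impulse tau t -> - K <= f t <= K)).
  - intros t. rewrite (impulse_period _ _ _ G).
    split; intros H' Ht; specialize (H' Ht);
      [rewrite (Hper t Ht)|rewrite (Hper t Ht) in H']; exact H'.
  - intros t Ht _. apply Rabs_le_between, HK. lra.
Qed.

(** Gronwall's argument in both directions of time.  The exponential absorbs
    the growth of the energy [y ^ 2 + v ^ 2] between impulse points; the step
    function with ratios [/ C i] (forward) or [C i] (backward) absorbs its
    jumps. *)
Lemma normalized_solution_unique (y v : R -> R) (t0 : R) :
  normalized_solution y v -> y t0 = 0 -> v t0 = 0 ->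
  forall t, y t = 0 /\ v t = 0.
Proof.
  intros [Hy Hv] Hy0 Hv0.
  destruct (periodic_bounded a Ha Ha_per) as [ka [Hka0 Hka]].
  destruct (periodic_bounded b Hb Hb_per) as [kb [Hkb0 Hkb]].
  destruct (periodic_bounded c Hc Hc_per) as [kc [Hkc0 Hkc]].
  set (K := 2 * ka + kb + kc).
  set (C := fun i => 2 + 2 * gamma i ^ 2).
  assert (HC : forall i, 0 < C i)
    by (intros i; unfold C; pose proof (pow2_ge_0 (gamma i)); lra).
  pose proof (pw_derive_plus tau _ _ _ _ _ _ (pw_derive_mult tau _ _ _ _ _ _ Hy Hy)
                (pw_derive_mult tau _ _ _ _ _ _ Hv Hv)) as HE.
  assert (Hzero : forall t, y t * y t + v t * v t <= 0 -> y t = 0 /\ v t = 0).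
  { intros t Ht. pose proof (Rle_0_sqr (y t)). pose proof (Rle_0_sqr (v t)).
    unfold Rsqr in *. split; apply Rsqr_0_uniq; unfold Rsqr; lra. }
  intros t. apply Hzero. destruct (Rle_lt_dec t0 t) as [L|L].
  - destruct (Z_prod (fun i => / C i)) as [w [Hw0 Hw]].
    { intros i. apply Rinv_neq_0_compat. apply Rgt_not_eq, HC. }
    pose proof (Z_prod_pos _ w Hw0 Hw (fun i => Rinv_0_lt_compat _ (HC i))) as Hwp.
    pose proof (pw_derive_mult tau _ _ _ _ _ _
      (pw_derive_mult tau _ _ _ _ _ _ HE
        (pw_derive_exp tau _ _ _ (pw_derive_scal tau (- K) _ _ _ (pw_derive_id tau))))
      (step_pw_derive T r tau G w)) as HF.
    cbv beta in HF.
    assert (M : (y t * y t + v t * v t) * exp (- K * t) * step T r tau G w t <=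
      (y t0 * y t0 + v t0 * v t0) * exp (- K * t0) * step T r tau G w t0).
    { apply (pw_derive_nonincreasing T r tau G _ _ _ t0 t HF L).
      - intros s Hs _. cbv beta.
        pose proof (energy_growth ka kb kc (a s) (b s) (c s) (y s) (v s)
          (Hka s Hs) (Hkb s Hs) (Hkc s Hs)) as [_ HG]. fold K in HG.
        pose proof (exp_pos (- K * s)) as He.
        assert (Hst : 0 < step T r tau G w s) by apply Hwp.
        rewrite Rmult_0_r, Rplus_0_r.
        apply Ropp_le_cancel. rewrite Ropp_0, <- Ropp_mult_distr_l_reverse.
        apply Rmult_le_pos; [|lra]. rewrite Rmult_1_r.
        match goal with |- 0 <= - (?d * _ + ?e * _) =>
          replace (- (d * exp (- K * s) + e * (- K * exp (- K * s))))
            with ((K * e - d) * exp (- K * s)) by ring end.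
        apply Rmult_le_pos; lra.
      - intros i _. cbv beta. unfold step. rewrite (cell_index_tau T r tau G), (Hw i).
        pose proof (energy_jump (gamma i) (y (tau i)) (v (tau i))) as HJ.
        fold (C i) in HJ.
        pose proof (exp_pos (- K * tau i)) as He. pose proof (Hwp (i - 1)%Z) as Hwi.
        set (E := exp _) in *. set (W := w (i - 1)%Z) in *.
        set (e1 := _ + (_ - _) * _) in *.
        apply Rle_trans with
          (C i * (y (tau i) * y (tau i) + v (tau i) * v (tau i)) * (E * W * / C i)).
        + replace (e1 * E * (W * / C i)) with (e1 * (E * W * / C i)) by ring.
          apply Rmult_le_compat_r; [|exact HJ].
          apply Rlt_le, Rmult_lt_0_compat; [now apply Rmult_lt_0_compat|].
          apply Rinv_0_lt_compat, HC.
        + right. field. apply Rgt_not_eq, HC. }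
    rewrite Hy0, Hv0 in M.
    assert (He : 0 < exp (- K * t) * step T r tau G w t)
      by (apply Rmult_lt_0_compat; [apply exp_pos|apply Hwp]).
    apply Rmult_le_reg_r with (1 := He). lra.
  - destruct (Z_prod C) as [w [Hw0 Hw]].
    { intros i. apply Rgt_not_eq, HC. }
    pose proof (Z_prod_pos _ w Hw0 Hw HC) as Hwp.
    pose proof (pw_derive_scal tau (-1) _ _ _ (pw_derive_mult tau _ _ _ _ _ _
      (pw_derive_mult tau _ _ _ _ _ _ HE
        (pw_derive_exp tau _ _ _ (pw_derive_scal tau K _ _ _ (pw_derive_id tau))))
      (step_pw_derive T r tau G w))) as HF.
    cbv beta in HF.
    assert (M : -1 * ((y t0 * y t0 + v t0 * v t0) * exp (K * t0) * step T r tau G w t0) <=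
      -1 * ((y t * y t + v t * v t) * exp (K * t) * step T r tau G w t)).
    { apply (pw_derive_nonincreasing T r tau G _ _ _ t t0 HF); [lra| |].
      - intros s Hs _. cbv beta.
        pose proof (energy_growth ka kb kc (a s) (b s) (c s) (y s) (v s)
          (Hka s Hs) (Hkb s Hs) (Hkc s Hs)) as [HG _]. fold K in HG.
        pose proof (exp_pos (K * s)) as He.
        assert (Hst : 0 < step T r tau G w s) by apply Hwp.
        rewrite Rmult_0_r, Rplus_0_r, Rmult_1_r.
        match goal with |- -1 * ((?d * _ + ?e * _) * _) <= 0 =>
          assert (0 <= (d + K * e) * exp (K * s) * step T r tau G w s) end.
        { apply Rmult_le_pos; [apply Rmult_le_pos|]; lra. }
        lra.
      - intros i _. cbv beta. unfold step. rewrite (cell_index_tau T r tau G), (Hw i).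
        pose proof (energy_jump (- gamma i) (y (tau i)) (v (tau i) - gamma i * y (tau i))) as HJ.
        replace (2 + 2 * (- gamma i) ^ 2) with (C i) in HJ by (unfold C; ring).
        replace (v (tau i) - gamma i * y (tau i) - - gamma i * y (tau i))
          with (v (tau i)) in HJ by ring.
        pose proof (exp_pos (K * tau i)) as He. pose proof (Hwp (i - 1)%Z) as Hwi.
        set (E := exp _) in *. set (W := w (i - 1)%Z) in *.
        set (e1 := _ + (_ - _) * _) in *.
        apply Ropp_le_cancel. ring_simplify.
        apply Rle_trans with ((C i * e1) * (E * W)); [|right; ring].
        apply Rle_trans with ((y (tau i) * y (tau i) + v (tau i) * v (tau i)) * (E * W));
          [right; ring|].
        apply Rmult_le_compat_r; [|exact HJ].
        now apply Rlt_le, Rmult_lt_0_compat. }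
    rewrite Hy0, Hv0 in M.
    assert (He : 0 < exp (K * t) * step T r tau G w t)
      by (apply Rmult_lt_0_compat; [apply exp_pos|apply Hwp]).
    apply Rmult_le_reg_r with (1 := He). lra.
Qed.

(** * Lyapunov's inequality *)

Lemma pw_continuous_pos_part (f : R -> R) :
  pw_continuous tau f -> pw_continuous tau (fun t => pos_part (f t)).
Proof. apply pw_continuous_comp, continuous_pos_part. Qed.

Lemma pw_continuous_Rabs (f : R -> R) :
  pw_continuous tau f -> pw_continuous tau (fun t => Rabs (f t)).
Proof. apply pw_continuous_comp, continuous_Rabs. Qed.

Lemma periodic_comp (h f : R -> R) :
  periodic T tau f -> periodic T tau (fun t => h (f t)).
Proof. intros H t Ht. now rewrite H. Qed.

Lemma RInt_nonneg_mono (f : R -> R) (s t : R) :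
  pw_continuous tau f -> (forall x, ~ impulse tau x -> 0 <= f x) -> s <= t ->
  RInt f 0 s <= RInt f 0 t.
Proof.
  intros Hf Hpos Hst.
  pose proof (pw_derive_scal tau (-1) _ _ _ (antiderivative_pw_derive T r tau G f Hf)) as H.
  assert (-1 * RInt f 0 t <= -1 * RInt f 0 s); [|lra].
  apply (pw_derive_nonincreasing T r tau G _ _ _ s t H Hst).
  - intros x Hx _. specialize (Hpos x Hx). lra.
  - intros i _. lra.
Qed.

(** Over one period an antiderivative of [f] varies by at most the integral of
    [Rabs f]. *)
Lemma RInt_variation (f : R -> R) (t0 s t : R) :
  pw_continuous tau f -> periodic T tau f ->
  t0 <= s <= t0 + T -> t0 <= t <= t0 + T ->
  RInt f 0 t - RInt f 0 s <= RInt (fun x => Rabs (f x)) 0 T.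
Proof.
  intros Hf Hper.
  pose proof (pw_continuous_Rabs f Hf) as Habs.
  pose proof (antiderivative_pw_derive T r tau G f Hf) as HF.
  pose proof (antiderivative_pw_derive T r tau G _ Habs) as HA.
  set (F := RInt f 0) in *. set (A := RInt (fun x => Rabs (f x)) 0) in *.
  assert (Hmon : forall s t, s <= t -> A s <= A t).
  { intros s' t' Hst. apply (RInt_nonneg_mono (fun x => Rabs (f x))).
    - exact Habs.
    - intros x _. apply Rabs_pos.
    - exact Hst. }
  assert (HAT : forall t, A (t + T) = A t + A T).
  { apply (antiderivative_period T r tau G _ Habs). now apply periodic_comp. }
  assert (Hvar : forall e s t, (e = 1 \/ e = -1) -> s <= t -> e * (F t - F s) <= A t - A s).
  { intros e s' t' He Hst.
    pose proof (pw_derive_plus tau _ _ _ _ _ _ (pw_derive_scal tau e _ _ _ HF)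
                  (pw_derive_scal tau (-1) _ _ _ HA)) as H.
    assert (e * F t' + -1 * A t' <= e * F s' + -1 * A s'); [|lra].
    apply (pw_derive_nonincreasing T r tau G _ _ _ s' t' H Hst).
    - intros x _ _. simpl. pose proof (Rle_abs (f x)). pose proof (Rle_abs (- f x)).
      rewrite Rabs_Ropp in *. destruct He as [-> | ->]; lra.
    - intros i _. simpl. lra. }
  intros Hs Ht.
  pose proof (HAT t0). pose proof (Hmon t0 s (proj1 Hs)). pose proof (Hmon t0 t (proj1 Ht)).
  pose proof (Hmon s (t0 + T) (proj2 Hs)). pose proof (Hmon t (t0 + T) (proj2 Ht)).
  destruct (Rle_lt_dec s t) as [L|L].
  - pose proof (Hvar 1 s t (or_introl eq_refl) L). lra.
  - pose proof (Hvar (-1) t s (or_intror eq_refl) ltac:(lra)). lra.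
Qed.

Section Lyapunov.

(* [sg i] accumulates the positive parts of the jump coefficients. *)
Context (sg : Z -> R) (Hsg0 : sg 0%Z = 0)
  (Hsg : forall i, sg i = sg (i - 1)%Z + pos_part (gamma i)).

(** Here [z = exp (- int a) * y] satisfies [z' = exp (- int a) * b * v], and
    [z * z] is maximal on the period at [ts].  The function [F eps] below is
    nonincreasing on [t0, t0 + T] for [eps = 1] and [eps = -1]; it is used on
    [t0, ts] with [eps = 1] and on [ts, t0 + T] with [eps = -1], and the terms
    in [y ts * v ts] cancel in the sum. *)
Lemma lyapunov_at_maximum (y v : R -> R) (t0 ts m mu : R) :
  normalized_solution y v ->
  t0 <= ts <= t0 + T -> y t0 = 0 -> y (t0 + T) = 0 -> 0 < mu ->
  (forall t, t0 <= t <= t0 + T ->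
     m <= RInt a 0 t <= m + RInt (fun x => Rabs (a x)) 0 T) ->
  0 < y ts ->
  (forall t, t0 <= t <= t0 + T ->
     (exp (- RInt a 0 t) * y t) ^ 2 <= (exp (- RInt a 0 ts) * y ts) ^ 2) ->
  2 <= exp (-2 * m) * RInt b 0 T / (2 * mu)
       + mu / 2 * (exp (2 * (m + RInt (fun x => Rabs (a x)) 0 T))
           * (RInt (fun x => pos_part (c x)) 0 T + sg (Z.of_nat r))).
Proof.
  intros [Hy Hv] Hts Hy0 HyT Hmu HA Hyts Hmax.
  set (L := RInt (fun x => Rabs (a x)) 0 T) in *.
  set (K1 := exp (-2 * m)). set (K2 := exp (2 * (m + L))).
  set (Z := exp (- RInt a 0 ts) * y ts) in *.
  assert (HZ : 0 < Z) by (apply Rmult_lt_0_compat; [apply exp_pos|exact Hyts]).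
  (* this scaling makes the final inequality homogeneous in Z *)
  set (lam := mu / Z).
  assert (Hlam : 0 < lam) by (apply Rdiv_lt_0_compat; assumption).
  set (N := Z ^ 2 * K2).
  assert (HN : forall t, t0 <= t <= t0 + T -> y t * y t <= N).
  { intros t Ht. specialize (Hmax t Ht). destruct (HA t Ht) as [_ HAt].
    replace (y t * y t) with ((exp (- RInt a 0 t) * y t) ^ 2 * exp (2 * RInt a 0 t)).
    - apply Rmult_le_compat; [apply pow2_ge_0|apply Rlt_le, exp_pos|exact Hmax|].
      apply exp_le. lra.
    - replace (exp (2 * RInt a 0 t)) with (exp (RInt a 0 t) * exp (RInt a 0 t))
        by (rewrite <- exp_plus; f_equal; ring).
      rewrite exp_Ropp. field. apply Rgt_not_eq, exp_pos. }
  assert (He : forall t, t0 <= t <= t0 + T ->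
             exp (- RInt a 0 t) * exp (- RInt a 0 t) <= K1).
  { intros t Ht. destruct (HA t Ht) as [HAt _]. rewrite <- exp_plus.
    apply exp_le. lra. }
  pose proof (antiderivative_pw_derive T r tau G a Ha) as HdA.
  pose proof (antiderivative_pw_derive T r tau G b Hb) as HdB.
  pose proof (antiderivative_pw_derive T r tau G _ (pw_continuous_pos_part c Hc)) as HdC.
  pose proof (pw_derive_mult tau _ _ _ _ _ _
    (pw_derive_exp tau _ _ _ (pw_derive_scal tau (-1) _ _ _ HdA)) Hy) as Hz.
  set (B := RInt b 0) in *. set (C := RInt (fun x => pos_part (c x)) 0) in *.
  set (S := step T r tau G sg).
  set (F := fun eps t => eps * (exp (-1 * RInt a 0 t) * y t) + - (lam / 2) * (y t * v t)
     + - (K1 / (2 * lam)) * B t + - (lam / 2 * N) * (C t + S t)).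
  assert (HF : forall eps p q, eps * eps = 1 -> t0 <= p -> p <= q -> q <= t0 + T ->
             F eps q <= F eps p).
  { intros eps p q Heps Hp Hpq Hq.
    pose proof (pw_derive_plus tau _ _ _ _ _ _
      (pw_derive_plus tau _ _ _ _ _ _
        (pw_derive_plus tau _ _ _ _ _ _ (pw_derive_scal tau eps _ _ _ Hz)
          (pw_derive_scal tau (- (lam / 2)) _ _ _ (pw_derive_mult tau _ _ _ _ _ _ Hy Hv)))
        (pw_derive_scal tau (- (K1 / (2 * lam))) _ _ _ HdB))
      (pw_derive_scal tau (- (lam / 2 * N)) _ _ _
         (pw_derive_plus tau _ _ _ _ _ _ HdC (step_pw_derive T r tau G sg)))) as H.
    apply (pw_derive_nonincreasing T r tau G _ _ _ p q H Hpq).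
    - intros t Ht Htpq. cbv beta.
      assert (Ht0 : t0 <= t <= t0 + T) by lra.
      pose proof (lyapunov_slope eps lam (exp (- RInt a 0 t)) K1 N (b t) (c t) (a t)
        (y t) (v t) Heps Hlam (Hb_pos t Ht) (He t Ht0) (HN t Ht0)) as HS.
      replace (-1 * RInt a 0 t) with (- RInt a 0 t) by ring.
      apply Rle_trans with (2 := HS). right. ring.
    - intros i Hi. cbv beta. unfold S, step.
      rewrite (cell_index_tau T r tau G), (Hsg i).
      pose proof (lyapunov_jump lam (gamma i) N (y (tau i)) (v (tau i)) Hlam
        (HN (tau i) ltac:(lra))) as HJ.
      lra. }
  assert (HBT : B (t0 + T) = B t0 + B T)
    by (apply (antiderivative_period T r tau G b Hb Hb_per)).
  assert (HCT : C (t0 + T) = C t0 + C T).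
  { apply (antiderivative_period T r tau G _ (pw_continuous_pos_part c Hc)).
    now apply periodic_comp. }
  assert (HST : S (t0 + T) = S t0 + sg (Z.of_nat r)).
  { unfold S, step. rewrite (cell_index_period T r tau G).
    apply (Z_sum_period r (fun i => pos_part (gamma i))); [exact Hsg0|exact Hsg|].
    intros i. now rewrite Hgamma_per. }
  pose proof (HF 1 t0 ts ltac:(ring) ltac:(lra) (proj1 Hts) (proj2 Hts)) as H1.
  pose proof (HF (-1) ts (t0 + T) ltac:(ring) (proj1 Hts) (proj2 Hts) ltac:(lra)) as H2.
  unfold F in H1, H2. rewrite Hy0 in H1. rewrite HyT, HBT, HCT, HST in H2.
  replace (-1 * RInt a 0 ts) with (- RInt a 0 ts) in H1, H2 by ring. fold Z in H1, H2.
  assert (H3 : 2 * Z <= K1 / (2 * lam) * B T + lam / 2 * N * (C T + sg (Z.of_nat r))) by lra.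
  apply Rmult_le_reg_r with (1 := HZ).
  apply Rle_trans with (1 := H3). right. unfold N, lam. field. lra.
Qed.

(** If [y] vanished on the whole period, [b * v = y' - a * y] would vanish at an
    interior point. *)
Lemma solution_nonzero_in_period (y v : R -> R) (t0 : R) :
  normalized_solution y v ->
  (forall t, ~ (y t = 0 /\ v t = 0)) ->
  exists t, t0 <= t <= t0 + T /\ y t <> 0.
Proof.
  intros [Hy Hv] Hnz. pose proof (grid_T _ _ _ G) as HT.
  apply Classical_Prop.NNPP. intros Hno.
  assert (Hz : forall t, t0 <= t <= t0 + T -> y t = 0).
  { intros t Ht. apply Classical_Prop.NNPP. intros H. apply Hno. now exists t. }
  destruct (right_cell T r tau G t0) as [i Hi].
  set (s := (t0 + Rmin (t0 + T) (tau (i + 1)%Z)) / 2).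
  assert (Hs : t0 < s < t0 + T /\ s < tau (i + 1)%Z).
  { unfold s, Rmin. destruct (Rle_dec (t0 + T) (tau (i + 1)%Z)); lra. }
  assert (Hsi : ~ impulse tau s) by (apply (open_cell_not_impulse T r tau G i); lra).
  apply (Hnz s). split; [apply Hz; lra|].
  pose proof (proj1 Hy s Hsi) as Hd.
  assert (Hd0 : is_derive y s 0).
  { apply is_derive_ext_loc with (f := fun _ => 0).
    - apply filter_imp with (2 := locally_between t0 (t0 + T) s (proj1 Hs)).
      intros x Hx. symmetry. apply Hz. lra.
    - apply (is_derive_const (K := R_AbsRing) (V := R_NormedModule)). }
  pose proof (is_derive_unique y s _ Hd) as E1. pose proof (is_derive_unique y s _ Hd0) as E2.
  rewrite E1 in E2. rewrite (Hz s) in E2 by lra.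
  pose proof (Hb_pos s Hsi). apply Rmult_eq_reg_l with (b s); lra.
Qed.

Lemma lyapunov_inequality (y v : R -> R) (t0 : R) :
  normalized_solution y v ->
  (forall t, ~ (y t = 0 /\ v t = 0)) ->
  y t0 = 0 -> y (t0 + T) = 0 ->
  4 <= exp (2 * RInt (fun x => Rabs (a x)) 0 T) * RInt b 0 T
       * (RInt (fun x => pos_part (c x)) 0 T + sg (Z.of_nat r)).
Proof.
  intros Hsol Hnz Hy0 HyT. pose proof (grid_T _ _ _ G) as HT.
  pose proof (pw_derive_continuous tau _ _ (antiderivative_pw_derive T r tau G a Ha)) as HcA.
  pose proof (pw_derive_continuous tau _ _ (proj1 Hsol)) as Hcy.
  assert (Hcz : forall t, continuous (fun t => (exp (- RInt a 0 t) * y t) ^ 2) t).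
  { intros t.
    assert (Hcz1 : continuous (fun t => exp (- RInt a 0 t) * y t) t).
    { apply (lim_mult (fun t => exp (- RInt a 0 t)) y); [|apply Hcy].
      apply (lim_comp exp (fun t => - RInt a 0 t)); [apply continuous_exp|].
      apply (lim_comp Ropp (RInt a 0)); [apply continuous_opp_R|apply HcA]. }
    apply (lim_mult (fun t => exp (- RInt a 0 t) * y t)); [exact Hcz1|].
    apply (lim_mult (fun t => exp (- RInt a 0 t) * y t)); [exact Hcz1|].
    apply filterlim_const. }
  destruct (continuity_ab_maj (fun t => (exp (- RInt a 0 t) * y t) ^ 2) t0 (t0 + T))
    as [ts [Hmax Hts]]; [lra|intros t _; apply continuity_pt_filterlim, Hcz|].
  destruct (continuity_ab_min (RInt a 0) t0 (t0 + T))
    as [tm [Hmin Htm]]; [lra|intros t _; apply continuity_pt_filterlim, HcA|].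
  set (L := RInt (fun x => Rabs (a x)) 0 T) in *.
  assert (HA : forall t, t0 <= t <= t0 + T ->
            RInt a 0 tm <= RInt a 0 t <= RInt a 0 tm + L).
  { intros t Ht. split; [now apply Hmin|].
    pose proof (RInt_variation a t0 tm t Ha Ha_per Htm Ht). fold L in H. lra. }
  assert (Hyts : y ts <> 0).
  { intros E. destruct (solution_nonzero_in_period y v t0 Hsol Hnz) as [t [Ht Hyt]].
    specialize (Hmax t Ht). simpl in Hmax. rewrite E in Hmax.
    assert (Hne : exp (- RInt a 0 t) * y t <> 0).
    { apply Rmult_integral_contrapositive_currified; [|exact Hyt].
      apply Rgt_not_eq, exp_pos. }
    apply Rsqr_pos_lt in Hne. unfold Rsqr in Hne. lra. }
  replace (exp (2 * L)) with (exp (-2 * RInt a 0 tm) * exp (2 * (RInt a 0 tm + L)))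
    by (rewrite <- exp_plus; f_equal; ring).
  set (K1 := exp (-2 * _)). set (K2 := exp (2 * (_ + _))).
  replace (K1 * K2 * RInt b 0 T * (RInt (fun x => pos_part (c x)) 0 T + sg (Z.of_nat r)))
    with ((K1 * RInt b 0 T) * (K2 * (RInt (fun x => pos_part (c x)) 0 T + sg (Z.of_nat r))))
    by ring.
  apply product_ge_four.
  - apply Rmult_le_pos; [apply Rlt_le, exp_pos|].
    pose proof (RInt_nonneg_mono b 0 T Hb (fun x Hx => Rlt_le _ _ (Hb_pos x Hx)) ltac:(lra)) as H.
    rewrite RInt_point in H. exact H.
  - intros mu Hmu. destruct (Rdichotomy _ _ Hyts) as [Hneg|Hpos].
    + (* pass to the opposite solution, as y + (-2) y *)
      pose proof (normalized_solution_combination (-2) y v y v Hsol Hsol) as Hopp.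
      refine (lyapunov_at_maximum _ _ t0 ts (RInt a 0 tm) mu Hopp Hts _ _ Hmu HA _ _);
        cbv beta; try lra.
      intros t Ht. specialize (Hmax t Ht).
      replace (y t + -2 * y t) with (- y t) by ring.
      replace (y ts + -2 * y ts) with (- y ts) by ring.
      replace (exp (- RInt a 0 t) * - y t) with (- (exp (- RInt a 0 t) * y t)) by ring.
      replace (exp (- RInt a 0 ts) * - y ts) with (- (exp (- RInt a 0 ts) * y ts)) by ring.
      now rewrite <- !Rsqr_pow2, <- !Rsqr_neg, !Rsqr_pow2.
    + exact (lyapunov_at_maximum y v t0 ts (RInt a 0 tm) mu Hsol Hts Hy0 HyT Hmu HA Hpos Hmax).
Qed.

End Lyapunov.

(** * Real multipliers and boundedness *)

(** The normalized forms of the two integral hypotheses of the theorem. *)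
Definition zero_mean : Prop :=
  RInt (fun t => c t - a t ^ 2 / b t) 0 T
  + sum_n_m (fun i : nat => gamma (Z.of_nat i)) 1 r = 0.

Definition lyapunov_condition : Prop :=
  exp (2 * RInt (fun t => Rabs (a t)) 0 T) * RInt b 0 T *
  (RInt (fun t => pos_part (c t)) 0 T
   + sum_n_m (fun i : nat => pos_part (gamma (Z.of_nat i))) 1 r) < 4.

Lemma mean_integrand_pw_continuous :
  pw_continuous tau (fun t => c t - a t ^ 2 / b t).
Proof.
  apply (pw_continuous_ext T r tau G (fun t => c t + -1 * (a t * (a t / b t)))).
  - intros t _. unfold Rdiv. ring.
  - apply pw_continuous_plus; [exact Hc|].
    apply (pw_continuous_comp tau (fun x => -1 * x)).
    + intros l. apply (lim_mult (fun _ => -1) (fun x => x));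
        [apply filterlim_const|apply filterlim_id].
    + now apply pw_continuous_mult.
Qed.

(** [w] is [- a / b] off the impulse points, and it satisfies the Riccati equation
    of [v / y] with its jumps; the quadratic term [b * (w + a / b) ^ 2] of this
    equation then vanishes. *)
Definition riccati_solution (w : R -> R) : Prop :=
  pw_derive tau w (fun t => - c t + a t ^ 2 / b t) (fun i => w (tau i) - gamma i) /\
  forall t, ~ impulse tau t -> a t / b t = - w t.

(** [H = v / y + int (c - a ^ 2 / b) + sum gamma] is nonincreasing, and it is
    periodic by the mean value hypothesis; hence it is constant. *)
Lemma zero_free_multiplier (y v : R -> R) (rho : R) :
  zero_mean ->
  normalized_solution y v ->
  (forall t, y (t + T) = rho * y t) -> (forall t, v (t + T) = rho * v t) ->
  (forall t, y t <> 0) ->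
  exists w, riccati_solution w.
Proof.
  unfold zero_mean. intros Hmean [Hy Hv] Hyr Hvr Hy0.
  pose proof (grid_T _ _ _ G) as HT.
  destruct (Z_sum gamma) as [sg [Hsg0 Hsg]].
  rewrite (Z_sum_sum_n_m gamma sg r (grid_r _ _ _ G) Hsg0 Hsg) in Hmean.
  set (f := fun t => c t - a t ^ 2 / b t) in *.
  pose proof mean_integrand_pw_continuous as Hf. fold f in Hf.
  assert (Hf_per : periodic T tau f).
  { intros t Ht. unfold f. now rewrite Ha_per, Hb_per, Hc_per. }
  set (w := fun t => v t * / y t).
  pose proof (pw_derive_mult tau _ _ _ _ _ _ Hv
    (pw_derive_inv tau _ _ _ Hy0 (fun i => Hy0 (tau i)) Hy)) as Hw.
  pose proof (pw_derive_plus tau _ _ _ _ _ _ Hw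
    (pw_derive_plus tau _ _ _ _ _ _ (antiderivative_pw_derive T r tau G f Hf)
       (step_pw_derive T r tau G sg))) as HH.
  set (H := fun t => w t + (RInt f 0 t + step T r tau G sg t)).
  (* H' = - b (w + a/b)^2, and the jumps of w and of the step function cancel *)
  assert (HHd : pw_derive tau H (fun t => - (b t * (w t + a t / b t) ^ 2))
                  (fun i => H (tau i))).
  { apply pw_derive_ext with (3 := HH).
    - intros t Ht. cbv beta. pose proof (Hb_pos t Ht). pose proof (Hy0 t).
      unfold f, w. field. repeat split; assumption || lra.
    - intros i. cbv beta. unfold H, w, step.
      rewrite (cell_index_tau T r tau G), (Hsg i). field. apply Hy0. }
  assert (HHper : forall t, H (t + T) = H t).
  { intros t. unfold H.
    rewrite (antiderivative_period T r tau G f Hf Hf_per).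
    unfold step. rewrite (cell_index_period T r tau G).
    pose proof (Z_sum_period r gamma sg Hsg0 Hsg Hgamma_per (cell_index T r tau G t)) as E.
    rewrite E.
    assert (Ew : w (t + T) = w t).
    { unfold w. pose proof (Hy0 (t + T)) as Hn. rewrite Hyr in Hn |- *. rewrite Hvr.
      pose proof (Hy0 t). field. split; [assumption|].
      intros E0. apply Hn. rewrite E0. ring. }
    rewrite Ew. lra. }
  assert (Hmon : forall s t, s <= t -> H t <= H s).
  { intros s t Hst. apply (pw_derive_nonincreasing T r tau G _ _ _ s t HHd Hst).
    - intros x Hx _. cbv beta. pose proof (Hb_pos x Hx).
      pose proof (pow2_ge_0 (w x + a x / b x)).
      assert (0 <= b x * (w x + a x / b x) ^ 2) by (apply Rmult_le_pos; lra). lra.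
    - intros i _. lra. }
  assert (Hwab : forall t, ~ impulse tau t -> a t / b t = - w t).
  { intros t Ht.
    (* H is constant on the period centred at t *)
    assert (Hd0 : is_derive H t 0).
    { apply is_derive_ext_loc with (f := fun _ => H (t - T / 2)).
      - apply filter_imp with
          (2 := locally_between (t - T / 2) (t - T / 2 + T) t ltac:(lra)).
        intros s Hs. apply Rle_antisym.
        + rewrite <- (HHper (t - T / 2)). apply Hmon. lra.
        + apply Hmon. lra.
      - apply (is_derive_const (K := R_AbsRing) (V := R_NormedModule)). }
    pose proof (is_derive_unique H t _ (proj1 HHd t Ht)) as E1.
    pose proof (is_derive_unique H t _ Hd0) as E2.
    rewrite E1 in E2. pose proof (Hb_pos t Ht).
    assert (E3 : (w t + a t / b t) ^ 2 = 0)
      by (apply Rmult_eq_reg_l with (b t); lra).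
    rewrite <- Rsqr_pow2 in E3. apply Rsqr_0_uniq in E3. lra. }
  exists w. split; [|exact Hwab].
  apply pw_derive_ext with (3 := Hw).
  - intros t Ht. cbv beta. pose proof (Hwab t Ht) as E. pose proof (Hb_pos t Ht) as Hbt.
    assert (Ea : a t = - (v t * / y t) * b t).
    { change (a t = - w t * b t). rewrite <- E. field. lra. }
    rewrite Ea. pose proof (Hy0 t). field. repeat split; assumption || lra.
  - intros i. cbv beta. unfold w. pose proof (Hy0 (tau i)). field. assumption.
Qed.

(** A zero of [y] is excluded by [lyapunov_inequality]. *)
Lemma multiplier_riccati (y v : R -> R) (rho : R) :
  zero_mean -> lyapunov_condition ->
  normalized_solution y v ->
  (forall t, ~ (y t = 0 /\ v t = 0)) ->
  (forall t, y (t + T) = rho * y t) -> (forall t, v (t + T) = rho * v t) ->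
  exists w, riccati_solution w.
Proof.
  intros Hmean Hlyap Hsol Hnz Hyr Hvr.
  apply (zero_free_multiplier y v rho Hmean Hsol Hyr Hvr).
  intros t0 Hy0. unfold lyapunov_condition in Hlyap.
  destruct (Z_sum (fun i => pos_part (gamma i))) as [sg [Hsg0 Hsg]].
  rewrite (Z_sum_sum_n_m _ sg r (grid_r _ _ _ G) Hsg0 Hsg) in Hlyap.
  assert (HyT : y (t0 + T) = 0) by (rewrite Hyr, Hy0; ring).
  pose proof (lyapunov_inequality sg Hsg0 Hsg y v t0 Hsol Hnz Hy0 HyT) as H.
  lra.
Qed.

(** The quadratic form [Y ^ 2 - q X Y + X ^ 2] in [X = f t], [Y = f (t + T)] is
    invariant under translation by [T], and positive definite. *)
Lemma elliptic_recurrence_bounded (f : R -> R) (q : R) :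
  -2 < q < 2 -> regulated f ->
  (forall t, f (t + T + T) = q * f (t + T) - f t) ->
  exists M, forall t, Rabs (f t) <= M.
Proof.
  intros Hq Hf Hrec. pose proof (grid_T _ _ _ G) as HT.
  set (I := fun t => f (t + T) * f (t + T) - q * (f t * f (t + T)) + f t * f t).
  assert (HI : forall t, I (t + T) = I t).
  { intros t. unfold I. rewrite Hrec. ring. }
  destruct (regulated_bounded f 0 T Hf ltac:(lra)) as [M0 [HM0 HM0']].
  destruct (regulated_bounded f T (T + T) Hf ltac:(lra)) as [M1 [HM1 HM1']].
  set (B := M1 * M1 + 2 * (M0 * M1) + M0 * M0).
  assert (HIB : forall t, I t <= B).
  { apply (period_induction T r tau G (fun t => I t <= B)).
    - intros t. rewrite HI. tauto.
    - intros t Ht. pose proof (HM0' t ltac:(lra)) as Hx.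
      pose proof (HM1' (t + T) ltac:(lra)) as Hy.
      unfold I, B. set (x := f t) in *. set (y := f (t + T)) in *.
      assert (Rabs x * Rabs x <= M0 * M0)
        by (apply Rmult_le_compat; auto using Rabs_pos).
      assert (Rabs y * Rabs y <= M1 * M1)
        by (apply Rmult_le_compat; auto using Rabs_pos).
      assert (Rabs x * Rabs y <= M0 * M1)
        by (apply Rmult_le_compat; auto using Rabs_pos).
      rewrite <- !Rabs_mult in *.
      assert (Rabs (q * (x * y)) <= 2 * (M0 * M1)).
      { rewrite Rabs_mult. apply Rmult_le_compat; auto using Rabs_pos.
        apply Rabs_le. lra. }
      pose proof (Rle_abs (x * x)). pose proof (Rle_abs (y * y)).
      pose proof (Rle_abs (- (q * (x * y)))) as Hm. rewrite Rabs_Ropp in Hm. lra. }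
  set (d := 1 - Rabs q / 2).
  assert (Hd : 0 < d) by (unfold d; assert (Rabs q < 2) by (apply Rabs_def1; lra); lra).
  assert (Hlow : forall t, d * (f t * f t) <= B).
  { intros t. specialize (HIB t). unfold I in HIB. unfold d.
    set (x := f t) in *. set (y := f (t + T)) in *.
    pose proof (Rle_0_sqr (x + y)) as Sp. pose proof (Rle_0_sqr (x - y)) as Sm.
    pose proof (Rle_0_sqr y) as Sy. unfold Rsqr in *.
    unfold Rabs. destruct (Rcase_abs q) as [L|L].
    - assert (0 <= - q * ((x + y) * (x + y))) by (apply Rmult_le_pos; lra).
      assert (0 <= (2 + q) * (y * y)) by (apply Rmult_le_pos; lra). lra.
    - assert (0 <= q * ((x - y) * (x - y))) by (apply Rmult_le_pos; lra).
      assert (0 <= (2 - q) * (y * y)) by (apply Rmult_le_pos; lra). lra. }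
  exists (B / d + 1). intros t.
  assert (H1 : f t * f t <= B / d).
  { apply Rmult_le_reg_l with (1 := Hd).
    apply Rle_trans with (1 := Hlow t). right. field. lra. }
  pose proof (Rle_0_sqr (Rabs (f t) - 1)) as H2. unfold Rsqr in H2.
  assert (E : Rabs (f t) * Rabs (f t) = f t * f t).
  { rewrite <- Rabs_mult. apply Rabs_pos_eq, Rle_0_sqr. }
  pose proof (Rabs_pos (f t)). nra.
Qed.

(** Boundedness follows once real multipliers are excluded, that is, once [- a / b]
    does not solve the Riccati equation. *)
Lemma normalized_solution_bounded (y v : R -> R) :
  zero_mean -> lyapunov_condition -> ~ (exists w, riccati_solution w) ->
  normalized_solution y v ->
  exists M, forall t, Rabs (y t) <= M /\ Rabs (v t) <= M.
Proof.
  intros Hmean Hlyap Hric Hsol.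
  assert (Hnomult : forall y v rho,
    normalized_solution y v -> (forall t, ~ (y t = 0 /\ v t = 0)) ->
    (forall t, y (t + T) = rho * y t /\ v (t + T) = rho * v t) -> False).
  { intros y' v' rho Hs Hnz Hr. apply Hric.
    apply (multiplier_riccati y' v' rho Hmean Hlyap Hs Hnz); intros t; apply Hr. }
  assert (Huniq : forall y v t0, normalized_solution y v ->
    y t0 = 0 -> v t0 = 0 -> forall t, y t = 0 /\ v t = 0).
  { exact (fun y v t0 => normalized_solution_unique y v t0). }
  destruct (Classical_Prop.classic (exists t, y t = 0 /\ v t = 0)) as [[t0 [Hy0 Hv0]]|Hnz].
  { exists 0. intros t. destruct (Huniq y v t0 Hsol Hy0 Hv0 t) as [-> ->].
    rewrite Rabs_R0. lra. }
  assert (Hnz' : forall t, ~ (y t = 0 /\ v t = 0)).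
  { intros t Ht. apply Hnz. now exists t. }
  pose proof (normalized_solution_shift) as Hshift.
  pose proof (Hshift y v Hsol) as Hsol1. pose proof (Hshift _ _ Hsol1) as Hsol2.
  set (y1 := fun t => y (t + T)) in *. set (v1 := fun t => v (t + T)) in *.
  set (D := y 0 * v1 0 - y1 0 * v 0).
  assert (HD : forall t, y t * v1 t - y1 t * v t = D).
  { intros t. exact (wronskian_constant y v y1 v1 Hsol Hsol1 t 0). }
  destruct (Req_dec D 0) as [D0|Dn0].
  - exfalso.
    (* the states at 0 and T are proportional *)
    assert (Hrho : exists rho, y1 0 = rho * y 0 /\ v1 0 = rho * v 0).
    { unfold D in D0. destruct (Req_dec (y 0) 0) as [E|E].
      - assert (Ev : v 0 <> 0) by (intros Ev; now apply (Hnz' 0)).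
        exists (v1 0 / v 0). rewrite E in D0 |- *. split; [|field; exact Ev].
        assert (E1 : y1 0 * v 0 = 0) by lra. apply Rmult_integral in E1.
        destruct E1 as [E1|E1]; [lra|contradiction].
      - exists (y1 0 / y 0). split; [field; exact E|].
        apply Rmult_eq_reg_l with (2 := E).
        replace (y 0 * (y1 0 / y 0 * v 0)) with (y1 0 * v 0) by (field; exact E). lra. }
    destruct Hrho as [rho [Hr1 Hr2]].
    apply (Hnomult y v rho Hsol Hnz'). intros t.
    pose proof (normalized_solution_combination (- rho) _ _ _ _ Hsol1 Hsol) as Hs.
    destruct (Huniq _ _ 0 Hs) with (t := t) as [H1 H2].
    + rewrite Hr1. ring.
    + rewrite Hr2. ring.
    + unfold y1 in H1. unfold v1 in H2. split; lra.
  - set (y2 := fun t => y1 (t + T)) in *. set (v2 := fun t => v1 (t + T)) in *.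
    set (q := (y 0 * v2 0 - y2 0 * v 0) / D).
    assert (Hq : forall t, y t * v2 t - y2 t * v t = q * D).
    { intros t. unfold q.
      rewrite (wronskian_constant y v y2 v2 Hsol Hsol2 t 0).
      field. exact Dn0. }
    assert (HD1 : forall t, y1 t * v2 t - y2 t * v1 t = D).
    { intros t. exact (HD (t + T)). }
    (* Cramer's rule in the basis of the two solutions and their shifts *)
    assert (Hy2 : forall t, y2 t = q * y1 t - y t).
    { intros t. apply Rmult_eq_reg_l with (2 := Dn0).
      replace (D * (q * y1 t - y t)) with ((q * D) * y1 t - D * y t) by ring.
      rewrite <- (Hq t). rewrite <- (HD t) at 1. rewrite <- (HD1 t). ring. }
    assert (Hv2 : forall t, v2 t = q * v1 t - v t).
    { intros t. apply Rmult_eq_reg_l with (2 := Dn0).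
      replace (D * (q * v1 t - v t)) with ((q * D) * v1 t - D * v t) by ring.
      rewrite <- (Hq t). rewrite <- (HD t) at 1. rewrite <- (HD1 t). ring. }
    assert (Hq2 : -2 < q < 2).
    { apply Classical_Prop.NNPP. intros Hn.
      (* otherwise rho^2 - q rho + 1 = 0 has the real roots (q + s)/2, (q - s)/2 *)
      assert (Hdisc : 0 <= q * q - 4).
      { destruct (Rle_lt_dec q (-2)) as [L|L]; [nra|].
        destruct (Rle_lt_dec 2 q) as [L'|L']; [nra|]. exfalso. apply Hn. lra. }
      set (s := sqrt (q * q - 4)).
      assert (Hs2 : s * s = q * q - 4) by (apply sqrt_sqrt; exact Hdisc).
      pose proof (normalized_solution_combination (- ((q - s) / 2))
        _ _ _ _ Hsol1 Hsol) as Hs.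
      apply (Hnomult _ _ ((q + s) / 2) Hs).
      - intros t [E1 E2]. apply Dn0. rewrite <- (HD t).
        replace (y1 t) with ((q - s) / 2 * y t) by lra.
        replace (v1 t) with ((q - s) / 2 * v t) by lra. ring.
      - intros t.
        change (y2 t + - ((q - s) / 2) * y1 t = (q + s) / 2 * (y1 t + - ((q - s) / 2) * y t) /\
                v2 t + - ((q - s) / 2) * v1 t = (q + s) / 2 * (v1 t + - ((q - s) / 2) * v t)).
        rewrite Hy2, Hv2.
        assert (E : (q + s) / 2 * ((q - s) / 2) = 1).
        { replace ((q + s) / 2 * ((q - s) / 2)) with ((q * q - s * s) / 4) by field.
          rewrite Hs2. field. }
        split.
        + replace ((q + s) / 2 * (y1 t + - ((q - s) / 2) * y t))
            with ((q + s) / 2 * y1 t - (q + s) / 2 * ((q - s) / 2) * y t) by ring.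
          rewrite E. field.
        + replace ((q + s) / 2 * (v1 t + - ((q - s) / 2) * v t))
            with ((q + s) / 2 * v1 t - (q + s) / 2 * ((q - s) / 2) * v t) by ring.
          rewrite E. field. }
    destruct (elliptic_recurrence_bounded y q Hq2) as [M1 HM1].
    { exact (pw_derive_regulated tau _ _ _ (proj1 Hsol)). }
    { exact Hy2. }
    destruct (elliptic_recurrence_bounded v q Hq2) as [M2 HM2].
    { exact (pw_derive_regulated tau _ _ _ (proj2 Hsol)). }
    { exact Hv2. }
    exists (Rmax M1 M2). intros t. split.
    + apply Rle_trans with (1 := HM1 t), Rmax_l.
    + apply Rle_trans with (1 := HM2 t), Rmax_r.
Qed.

End Normalized.

(** * Functions in PC[0,T] *)

Lemma is_derive_D_in (f f' : R -> R) (D : R -> Prop) (t : R) :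
  is_derive f t (f' t) -> D_in f f' D t.
Proof.
  intros H. apply is_derive_Reals in H. apply derivable_pt_lim_D_in in H.
  intros eps Heps. destruct (H eps Heps) as [alp [Halp Hlim]].
  exists alp. split; [exact Halp|]. intros x [[_ Hx] Hd].
  apply Hlim. split; [split; [exact I|exact Hx]|exact Hd].
Qed.

Section PC.

Context (T : R) (r : nat) (tau : Z -> R) (G : impulse_grid T r tau).

Lemma PC_dom_left (t : R) : 0 < t <= T -> at_left t (PC_dom T r tau).
Proof.
  intros Ht.
  apply (filter_imp (fun s => 0 < s < t /\ ~ impulse tau s)).
  - intros s [Hs Hs']. apply (PC_dom_iff T r tau G). split; [lra|exact Hs'].
  - apply filter_and; [now apply at_left_open|apply (at_left_not_impulse T r tau G)].
Qed.

Lemma PC_dom_right (t : R) : 0 <= t < T -> at_right t (PC_dom T r tau).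
Proof.
  intros Ht.
  apply (filter_imp (fun s => t < s < T /\ ~ impulse tau s)).
  - intros s [Hs Hs']. apply (PC_dom_iff T r tau G). split; [lra|exact Hs'].
  - apply filter_and; [now apply at_right_open|apply (at_right_not_impulse T r tau G)].
Qed.

Lemma periodic_left (f : R -> R) (t l : R) :
  periodic T tau f ->
  filterlim f (at_left (t + T)) (locally l) <-> filterlim f (at_left t) (locally l).
Proof.
  intros Hper. rewrite <- lim_left_shift.
  assert (E : at_left t (fun s => f (s + T) = f s)).
  { apply filter_imp with (2 := at_left_not_impulse T r tau G t). exact Hper. }
  split; apply filterlim_ext_loc; [exact E|].
  apply filter_imp with (2 := E). intros s Hs. now symmetry.
Qed.

Lemma periodic_right (f : R -> R) (t l : R) :
  periodic T tau f ->
  filterlim f (at_right (t + T)) (locally l) <-> filterlim f (at_right t) (locally l).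
Proof.
  intros Hper. rewrite <- lim_right_shift.
  assert (E : at_right t (fun s => f (s + T) = f s)).
  { apply filter_imp with (2 := at_right_not_impulse T r tau G t). exact Hper. }
  split; apply filterlim_ext_loc; [exact E|].
  apply filter_imp with (2 := E). intros s Hs. now symmetry.
Qed.

Lemma zero_not_impulse : ~ impulse tau 0.
Proof.
  intros [i Hi]. pose proof (grid_T _ _ _ G).
  assert (Hin : index_1_r r i) by (apply (impulse_in_period T r tau G); lra).
  pose proof (index_in_period T r tau G i Hin). lra.
Qed.

(** The restrictions to [0,T] glue continuously at the ends of the period, since
    0 and T are not impulse points. *)
Lemma PC_pw_continuous (f : R -> R) :
  PC T r tau f -> periodic T tau f -> pw_continuous tau f.
Proof.
  intros [Hcont Hlim] Hper. pose proof (grid_T _ _ _ G) as HT.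
  assert (Q : forall t,
    ((exists l, filterlim f (at_left t) (locally l)) /\
     (exists l, filterlim f (at_right t) (locally l))) /\
    (~ impulse tau t -> filterlim f (at_left t) (locally (f t)) /\
                        filterlim f (at_right t) (locally (f t)))).
  { apply (period_induction T r tau G (fun t =>
      ((exists l, filterlim f (at_left t) (locally l)) /\
       (exists l, filterlim f (at_right t) (locally l))) /\
      (~ impulse tau t -> filterlim f (at_left t) (locally (f t)) /\
                          filterlim f (at_right t) (locally (f t))))).
    - intros t. rewrite (impulse_period T r tau G).
      setoid_rewrite periodic_left; [|exact Hper|exact Hper].
      setoid_rewrite periodic_right; [|exact Hper|exact Hper].
      split; intros [H1 H2]; (split; [exact H1|]); intros Ht; specialize (H2 Ht);
        [rewrite (Hper t Ht)|rewrite (Hper t Ht) in H2]; exact H2.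
    - intros t Ht.
      assert (Hni : ~ impulse tau t -> filterlim f (at_left t) (locally (f t)) /\
                        filterlim f (at_right t) (locally (f t))).
      { intros Hi. split.
        - apply within_left with (1 := PC_dom_left t Ht). apply Hcont.
          apply (PC_dom_iff T r tau G). split; [lra|exact Hi].
        - destruct (Rle_lt_or_eq_dec _ _ (proj2 Ht)) as [L| ->].
          + apply within_right with (1 := PC_dom_right t (conj (Rlt_le _ _ (proj1 Ht)) L)).
            apply Hcont. apply (PC_dom_iff T r tau G). split; [lra|exact Hi].
          + pose proof zero_not_impulse as H0.
            replace T with (0 + T) by ring. rewrite (Hper 0 H0).
            apply periodic_right; [exact Hper|].
            apply within_right with (1 := PC_dom_right 0 ltac:(lra)). apply Hcont.
            apply (PC_dom_iff T r tau G). split; [lra|exact H0]. }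
      split; [|exact Hni].
      destruct (Classical_Prop.classic (impulse tau t)) as [[i ->]|Hi].
      + apply Hlim, (impulse_in_period T r tau G). lra.
      + destruct (Hni Hi). split; now exists (f t). }
  split.
  - intros t. apply Q.
  - intros t Ht. apply continuous_two_sided; now apply Q.
Qed.

Lemma pw_continuous_PC (f : R -> R) : pw_continuous tau f -> PC T r tau f.
Proof.
  intros [Hf Hc]. split.
  - intros t Ht. apply (PC_dom_iff T r tau G) in Ht.
    apply filterlim_filter_le_1 with (2 := Hc t (proj2 Ht)). apply filter_le_within.
  - intros i _. apply Hf.
Qed.

(** A function with a continuous extension [g] to [0,T] is in PC[0,T], with both
    one-sided limits equal to the value of [g] at each impulse point. *)
Lemma extends_to_C_PC (f g : R -> R) :
  continuous_on (fun t => 0 <= t <= T) g ->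
  (forall t, PC_dom T r tau t -> g t = f t) ->
  PC T r tau f /\
  forall i, index_1_r r i -> filterlim f (at_left (tau i)) (locally (g (tau i))) /\
                             filterlim f (at_right (tau i)) (locally (g (tau i))).
Proof.
  intros Hg Hgf.
  assert (Hlim : forall i, index_1_r r i ->
            filterlim f (at_left (tau i)) (locally (g (tau i))) /\
            filterlim f (at_right (tau i)) (locally (g (tau i)))).
  { intros i Hi. pose proof (index_in_period T r tau G i Hi) as Hti.
    assert (HL : at_left (tau i) (PC_dom T r tau)) by (apply PC_dom_left; lra).
    assert (HR : at_right (tau i) (PC_dom T r tau)) by (apply PC_dom_right; lra).
    split.
    - apply filterlim_ext_loc with (f := g); [now apply filter_imp with (2 := HL)|].
      apply (within_left (fun t => 0 <= t <= T)); [|apply Hg; lra].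
      apply filter_imp with (2 := HL). intros t Ht. apply Ht.
    - apply filterlim_ext_loc with (f := g); [now apply filter_imp with (2 := HR)|].
      apply (within_right (fun t => 0 <= t <= T)); [|apply Hg; lra].
      apply filter_imp with (2 := HR). intros t Ht. apply Ht. }
  split; [|exact Hlim]. split.
  - intros t Ht. rewrite <- (Hgf t Ht).
    apply filterlim_within_ext with (f := g); [exact Hgf|].
    intros P HP. pose proof (Hg t (proj1 Ht) P HP) as H.
    unfold filtermap, within in *. apply filter_imp with (2 := H).
    intros s Hs Hs'. apply Hs, Hs'.
  - intros i Hi. destruct (Hlim i Hi). split; now exists (g (tau i)).
Qed.

(** Derivatives relative to PC_dom are therefore unique, even at 0 and T. *)
Lemma PC_dom_adherent (t : R) :
  PC_dom T r tau t -> adhDa (D_x (PC_dom T r tau) t) t.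
Proof.
  intros Ht alp Halp. pose proof (grid_T _ _ _ G) as HT.
  assert (Ht0 : 0 <= t <= T) by apply Ht.
  destruct (Rle_lt_dec T t) as [L|L].
  - assert (H : at_left t (fun s => PC_dom T r tau s /\ t - alp < s < t))
      by (apply filter_and; [apply PC_dom_left|apply at_left_open]; lra).
    destruct (filter_ex (F := at_left t) _ H) as [s [Hs Hst]].
    exists s. split; [split; [exact Hs|lra]|]. unfold Rdist. apply Rabs_def1; lra.
  - assert (H : at_right t (fun s => PC_dom T r tau s /\ t < s < t + alp))
      by (apply filter_and; [apply PC_dom_right|apply at_right_open]; lra).
    destruct (filter_ex (F := at_right t) _ H) as [s [Hs Hst]].
    exists s. split; [split; [exact Hs|lra]|]. unfold Rdist. apply Rabs_def1; lra.
Qed.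

End PC.

(** * Normalization of solutions *)

(** The values of [x] at the impulse points are replaced by its left-hand
    limits. *)
Lemma left_regularization (T : R) (r : nat) (tau : Z -> R)
  (G : impulse_grid T r tau) (x dx : R -> R) (j : Z -> R) :
  (forall t, ~ impulse tau t -> is_derive x t (dx t)) ->
  (forall i, exists l, filterlim x (at_left (tau i)) (locally l)) ->
  (forall i, filterlim x (at_right (tau i)) (locally (j i))) ->
  exists X, (forall t, ~ impulse tau t -> x t = X t) /\ pw_derive tau X dx j.
Proof.
  intros Hd HL HR.
  assert (Hlim : forall t, exists l, filterlim x (at_left t) (locally l) /\
                                     (~ impulse tau t -> x t = l)).
  { intros t. destruct (Classical_Prop.classic (impulse tau t)) as [[i ->]|Ht].
    - destruct (HL i) as [l Hl]. exists l. split; [exact Hl|].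
      intros H. destruct H. now exists i.
    - exists (x t). split; [|reflexivity].
      apply continuous_left, (ex_derive_continuous (K := R_AbsRing) x).
      exists (dx t). now apply Hd. }
  set (X := fun t => proj1_sig (constructive_indefinite_description _ (Hlim t))).
  assert (HX : forall t, filterlim x (at_left t) (locally (X t)) /\
                         (~ impulse tau t -> x t = X t)).
  { intros t. unfold X. now destruct (constructive_indefinite_description _ _). }
  exists X. split; [intros t; apply HX|]. split.
  - intros t Ht. apply is_derive_ext_loc with (f := x); [|now apply Hd].
    apply filter_imp with (2 := locally_not_impulse T r tau G t Ht).
    intros s Hs. now apply HX.
  - intros i. split.
    + apply filterlim_ext_loc with (f := x); [|apply HX].
      apply filter_imp with (2 := at_left_not_impulse T r tau G (tau i)).
      intros s Hs. now apply HX.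
    + apply filterlim_ext_loc with (f := x); [|apply HR].
      apply filter_imp with (2 := at_right_not_impulse T r tau G (tau i)).
      intros s Hs. now apply HX.
Qed.

Lemma pw_derive_left_value (T : R) (r : nat) (tau : Z -> R)
  (G : impulse_grid T r tau) (x X dx : R -> R) (j : Z -> R) (i : Z) (l : R) :
  (forall t, ~ impulse tau t -> x t = X t) -> pw_derive tau X dx j ->
  filterlim x (at_left (tau i)) (locally l) -> X (tau i) = l.
Proof.
  intros E [_ HX] Hl.
  apply (lim_unique (F := at_left (tau i)) X); [apply HX|].
  apply filterlim_ext_loc with (f := x); [|exact Hl].
  apply filter_imp with (2 := at_left_not_impulse T r tau G (tau i)). exact E.
Qed.

(** With [pi] the two-sided product of the [alpha i], division by [step pi] turns
    a solution into a normalized one. *)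
Lemma solution_normalization (T : R) (r : nat) (tau : Z -> R)
  (G : impulse_grid T r tau) (a b c : R -> R) (alpha beta pi : Z -> R) :
  (forall i, alpha i <> 0) -> (forall i, pi i <> 0) ->
  (forall i, pi i = pi (i - 1)%Z * alpha i) ->
  forall x u, is_solution tau alpha beta a b c x u ->
  exists y v,
    normalized_solution tau a b c (fun i => beta i / alpha i) y v /\
    forall t, ~ impulse tau t ->
      x t = step T r tau G pi t * y t /\ u t = step T r tau G pi t * v t.
Proof.
  intros Halpha Hpin Hpi x u [Hode Hjump].
  assert (Hx : exists xp : Z -> R, forall i, filterlim x (at_right (tau i)) (locally (xp i))).
  { assert (H : forall i, exists l, filterlim x (at_right (tau i)) (locally l)).
    { intros i. destruct (Hjump i) as (xm & xp & um & up & _ & H & _). now exists xp. }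
    exists (fun i => proj1_sig (constructive_indefinite_description _ (H i))).
    intros i. now destruct (constructive_indefinite_description _ _). }
  assert (Hu : exists up : Z -> R, forall i, filterlim u (at_right (tau i)) (locally (up i))).
  { assert (H : forall i, exists l, filterlim u (at_right (tau i)) (locally l)).
    { intros i. destruct (Hjump i) as (xm & xp & um & up & _ & _ & _ & H & _). now exists up. }
    exists (fun i => proj1_sig (constructive_indefinite_description _ (H i))).
    intros i. now destruct (constructive_indefinite_description _ _). }
  destruct Hx as [xp Hxp]. destruct Hu as [up Hup].
  destruct (left_regularization T r tau G x (fun t => a t * x t + b t * u t) xp)
    as [X [HX HXd]].
  { intros t Ht. now apply Hode. }
  { intros i. destruct (Hjump i) as (xm & ? & ? & ? & H & _). now exists xm. }
  { exact Hxp. }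
  destruct (left_regularization T r tau G u (fun t => - c t * x t - a t * u t) up)
    as [U [HU HUd]].
  { intros t Ht. now apply Hode. }
  { intros i. destruct (Hjump i) as (? & ? & um & ? & _ & _ & H & _). now exists um. }
  { exact Hup. }
  assert (Hjmp : forall i, xp i = alpha i * X (tau i) /\
                           up i = alpha i * U (tau i) - beta i * X (tau i)).
  { intros i. destruct (Hjump i) as (xm & xp' & um & up' & H1 & H2 & H3 & H4 & H5 & H6).
    rewrite (pw_derive_left_value T r tau G x X _ _ i xm HX HXd H1).
    rewrite (pw_derive_left_value T r tau G u U _ _ i um HU HUd H3).
    rewrite <- H5, <- H6. split.
    - exact (lim_unique (F := at_right (tau i)) x _ _ (Hxp i) H2).
    - exact (lim_unique (F := at_right (tau i)) u _ _ (Hup i) H4). }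
  pose proof (step_pw_derive T r tau G (fun i => / pi i)) as Hs.
  pose proof (pw_derive_mult tau _ _ _ _ _ _ HXd Hs) as Hy.
  pose proof (pw_derive_mult tau _ _ _ _ _ _ HUd Hs) as Hv.
  exists (fun t => X t * step T r tau G (fun i => / pi i) t),
         (fun t => U t * step T r tau G (fun i => / pi i) t).
  split; [split|].
  - apply pw_derive_ext with (3 := Hy); cbv beta.
    + intros t Ht. rewrite (HX t Ht), (HU t Ht). ring.
    + intros i. destruct (Hjmp i) as [-> _].
      unfold step. rewrite (cell_index_tau T r tau G), (Hpi i).
      field. auto.
  - apply pw_derive_ext with (3 := Hv); cbv beta.
    + intros t Ht. rewrite (HX t Ht), (HU t Ht). ring.
    + intros i. destruct (Hjmp i) as [_ ->].
      unfold step. rewrite (cell_index_tau T r tau G), (Hpi i).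
      field. auto.
  - intros t Ht. rewrite (HX t Ht), (HU t Ht). unfold step.
    split; field; apply Hpin.
Qed.

(** Over one period the step function is multiplied by [kappa], which is 1 or -1. *)
Lemma step_bounded (T : R) (r : nat) (tau : Z -> R)
  (G : impulse_grid T r tau) (pi : Z -> R) (kappa : R) :
  kappa ^ 2 = 1 -> (forall i, pi (i + Z.of_nat r)%Z = kappa * pi i) ->
  exists K, 0 <= K /\ forall t, Rabs (step T r tau G pi t) <= K.
Proof.
  intros Hk Hper. pose proof (grid_T _ _ _ G) as HT.
  destruct (regulated_bounded (step T r tau G pi) 0 T) as [K [HK0 HK]].
  { exact (pw_derive_regulated tau _ _ _ (step_pw_derive T r tau G pi)). }
  { lra. }
  assert (Habs : Rabs kappa = 1).
  { destruct (Rabs_pos kappa) as [L|E].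
    - rewrite <- Rsqr_pow2, Rsqr_abs in Hk. unfold Rsqr in Hk. nra.
    - rewrite <- Rsqr_pow2, Rsqr_abs, <- E in Hk. unfold Rsqr in Hk. lra. }
  exists K. split; [exact HK0|].
  apply (period_induction T r tau G (fun t => Rabs (step T r tau G pi t) <= K)).
  - intros t. unfold step.
    rewrite (cell_index_period T r tau G), Hper, Rabs_mult, Habs, Rmult_1_l. tauto.
  - intros t Ht. apply HK. lra.
Qed.

Theorem theorem3p2
  (T : R) (r : nat) (tau alpha beta : Z -> R) (a b c : R -> R)
  (HT : 0 < T) (Hr : (0 < r)%nat)
  (Htau_incr : forall i : Z, tau i < tau (i + 1)%Z)
  (Htau_per : forall i : Z, tau (i + Z.of_nat r)%Z = tau i + T)
  (Htau_first : 0 < tau 1%Z) (Htau_last : tau (Z.of_nat r) < T)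
  (Ha_per : forall t : R, ~ impulse tau t -> a (t + T) = a t)
  (Hb_per : forall t : R, ~ impulse tau t -> b (t + T) = b t)
  (Hc_per : forall t : R, ~ impulse tau t -> c (t + T) = c t)
  (Ha_PC : PC T r tau a) (Hb_PC : PC T r tau b) (Hc_PC : PC T r tau c)
  (Halpha_neq0 : forall i : Z, alpha i <> 0)
  (Halpha_per : forall i : Z, alpha (i + Z.of_nat r)%Z = alpha i)
  (Hbeta_per : forall i : Z, beta (i + Z.of_nat r)%Z = beta i)
  (Hprod : prod_f_R0 (fun k : nat => alpha (Z.of_nat (S k)) ^ 2) (r - 1) = 1)
  (Hlyap :
     exp (2 * RInt (fun t => Rabs (a t)) 0 T) *
     RInt b 0 T *
     (RInt (fun t => pos_part (c t)) 0 T +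
      sum_n_m (fun i : nat => pos_part (beta (Z.of_nat i) / alpha (Z.of_nat i))) 1 r)
     < 4)
  (Hb_pos : forall t : R, ~ impulse tau t -> 0 < b t)
  (Hmean :
     RInt (fun t => c t - a t ^ 2 / b t) 0 T +
     sum_n_m (fun i : nat => beta (Z.of_nat i) / alpha (Z.of_nat i)) 1 r = 0)
  (Hab_C : extends_to_C T r tau (fun t => a t / b t))
  (HC :
     (* (C1) *)
     (exists i : Z, index_1_r r i /\ beta i <> 0) \/
     (* (C2) *)
     ((forall i : Z, index_1_r r i -> beta i = 0) /\
      ~ PC1 T r tau (fun t => a t / b t)) \/
     (* (C3) *)
     ((forall i : Z, index_1_r r i -> beta i = 0) /\
      PC1 T r tau (fun t => a t / b t) /\
      (exists d : R -> R,
         is_PC_derivative T r tau (fun t => a t / b t) d /\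
         (exists t : R, PC_dom T r tau t /\ d t - c t + a t ^ 2 / b t <> 0)))) :
  stable tau alpha beta a b c.
Proof.
  assert (G : impulse_grid T r tau) by (constructor; assumption).
  assert (Ha : pw_continuous tau a) by (apply (PC_pw_continuous T r tau G); assumption).
  assert (Hb : pw_continuous tau b) by (apply (PC_pw_continuous T r tau G); assumption).
  assert (Hc : pw_continuous tau c) by (apply (PC_pw_continuous T r tau G); assumption).
  destruct Hab_C as [g [Hg Hgf]].
  destruct (extends_to_C_PC T r tau G _ g Hg Hgf) as [Hab_PC Hab_lim].
  assert (Hab : pw_continuous tau (fun t => a t / b t)).
  { apply (PC_pw_continuous T r tau G); [exact Hab_PC|].
    intros t Ht. now rewrite Ha_per, Hb_per. }
  set (gamma := fun i => beta i / alpha i).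
  assert (Hgamma_per : forall i, gamma (i + Z.of_nat r)%Z = gamma i).
  { intros i. unfold gamma. now rewrite Halpha_per, Hbeta_per. }
  assert (Hric : ~ exists w, riccati_solution tau a b c gamma w).
  { intros [w [Hw Hwab]].
    (* a/b = - w has the derivative c - a^2/b *)
    assert (Hder : forall D t, ~ impulse tau t ->
              D_in (fun t => a t / b t) (fun t => c t - a t ^ 2 / b t) D t).
    { intros D t Ht. apply is_derive_D_in.
      apply is_derive_ext_loc with (f := fun t => - w t).
      - apply filter_imp with (2 := locally_not_impulse T r tau G t Ht).
        intros s Hs. symmetry. now apply Hwab.
      - replace (c t - a t ^ 2 / b t) with (- (- c t + a t ^ 2 / b t)) by ring.
        apply (is_derive_opp w). now apply Hw. }
    destruct HC as [[i [Hi Hbeta]]|[[_ HC2]|[_ [_ [d [Hd [t [Ht Hne]]]]]]]].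
    - (* a/b has equal one-sided limits at tau i, so w has no jump there *)
      destruct (Hab_lim i Hi) as [HL HR]. destruct Hw as [_ Hw].
      destruct (Hw i) as [HwL HwR].
      assert (E1 : g (tau i) = - w (tau i)).
      { apply (lim_unique (F := at_left (tau i)) (fun t => a t / b t)); [exact HL|].
        apply filterlim_ext_loc with (f := fun t => - w t).
        - apply filter_imp with (2 := at_left_not_impulse T r tau G (tau i)).
          intros s Hs. symmetry. now apply Hwab.
        - now apply (lim_comp Ropp w); [apply continuous_opp_R|]. }
      assert (E2 : g (tau i) = - (w (tau i) - gamma i)).
      { apply (lim_unique (F := at_right (tau i)) (fun t => a t / b t)); [exact HR|].
        apply filterlim_ext_loc with (f := fun t => - w t).
        - apply filter_imp with (2 := at_right_not_impulse T r tau G (tau i)).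
          intros s Hs. symmetry. now apply Hwab.
        - now apply (lim_comp Ropp w); [apply continuous_opp_R|]. }
      apply Hbeta. assert (E3 : gamma i = 0) by lra.
      unfold gamma in E3. apply Rmult_integral in E3. destruct E3 as [E3|E3]; [exact E3|].
      now apply Rinv_neq_0_compat in E3.
    - apply HC2. split; [exact Hab_PC|].
      exists (fun t => c t - a t ^ 2 / b t). split.
      + intros t Ht. apply Hder. now apply (PC_dom_iff T r tau G).
      + apply (pw_continuous_PC T r tau G), (mean_integrand_pw_continuous T r tau G a b c); assumption.
    - apply Hne.
      assert (E : d t = c t - a t ^ 2 / b t); [|lra].
      apply (single_limit _ (D_x (PC_dom T r tau) t) _ _ t (PC_dom_adherent T r tau G t Ht)
               (Hd t Ht)).
      apply (Hder (PC_dom T r tau) t). now apply (PC_dom_iff T r tau G). }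
  destruct (Z_prod alpha Halpha_neq0) as [pi [Hpi0 Hpi]].
  pose proof (Z_prod_neq0 alpha pi Hpi0 Hpi Halpha_neq0) as Hpin.
  pose proof (Z_prod_period r alpha pi Hpi0 Hpi Halpha_neq0 Halpha_per) as Hpi_per.
  assert (Hkappa : pi (Z.of_nat r) ^ 2 = 1)
    by (rewrite <- (Z_prod_prod_f_R0 alpha pi r Hr Hpi0 Hpi); exact Hprod).
  destruct (step_bounded T r tau G pi (pi (Z.of_nat r)) Hkappa Hpi_per) as [K [HK0 HK]].
  intros x u Hxu.
  destruct (solution_normalization T r tau G a b c alpha beta pi Halpha_neq0 Hpin Hpi x u Hxu)
    as [y [v [Hsol Hyv]]].
  destruct (normalized_solution_bounded T r tau G a b c gamma Ha Hb Hc Hab Ha_per Hb_per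
    Hc_per Hgamma_per Hb_pos y v Hmean Hlyap Hric Hsol) as [M HM].
  exists (K * M). intros t Ht. destruct (Hyv t Ht) as [-> ->]. destruct (HM t).
  rewrite !Rabs_mult.
  split; apply Rmult_le_compat; auto using Rabs_pos.
Qed.
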